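(* Let $\alpha\in(0,1)$, $T>0$, $\mathcal{A}\in\mathbb{C}^{d\times d}$, $\vartheta\in\mathcal{C}[0,T]$ and $x_0\in\mathbb{C}^d$. Then the function $$x(t)=\mathcal{E}_\alpha(\mathcal{A}t)x_0+\sum_{j=0}^\infty\mathcal{A}^j\,{}^LJ^{(j+1)\circ\alpha}\vartheta(t)$$ is well defined, belongs to $\mathcal{C}[0,T]$, and satisfies for every $t\in[0,T]$ the integral equation $$x(t)=x_0+\frac{1}{\Gamma(\alpha)\Gamma(2-\alpha)}\int_0^t (t-s)^{\alpha-1}s^{1-\alpha}\big(\mathcal{A}x(s)+\vartheta(s)\big)\,ds .$$ If $x$ and $\vartheta$ are absolutely continuous on $[0,T]$, then $x$ satisfies ${}^LD^\alpha x(t)=\mathcal{A}x(t)+\vartheta(t)$ for almost every $t\in[0,T]$, with $x(0)=x_0$. If $x$ and $\vartheta$ are given by power series absolutely convergent on $[0,T]$, then this equation holds for every $t\in[0,T]$.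
   Context: Mittag–Leffler-type function: $\mathcal{E}_\alpha(s)=\sum_{n=0}^\infty\frac{s^n}{\Gamma(2-\alpha)^n\prod_{j=1}^n\frac{\Gamma(j+1)}{\Gamma(j+1-\alpha)}}$, also for square matrix arguments. $\mathcal{C}[0,T]$: continuous functions $[0,T]\to\mathbb{C}^d$. L-fractional integral ${}^LJ^\alpha y(t)=\frac{1}{\Gamma(\alpha)\Gamma(2-\alpha)}\int_0^t (t-s)^{\alpha-1}s^{1-\alpha}y(s)\,ds$, with $m$-fold composition ${}^LJ^{m\circ\alpha}$. Caputo derivative ${}^CD^\alpha x(t)=\frac{1}{\Gamma(1-\alpha)}\int_0^t (t-\tau)^{-\alpha}x'(\tau)d\tau$ for absolutely continuous $x$ ($x'\in L^1$, $x(t)=x(0)+\int_0^tx'$); L-fractional derivative ${}^LD^\alpha x(t)=\frac{\Gamma(2-\alpha)}{t^{1-\alpha}}{}^CD^\alpha x(t)$, extended at $t=0$ by continuity (value $x'(0)$) for $C^2$ functions. *)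

(* Defs.v *)
From HB Require Import structures.
From mathcomp Require Import all_boot all_order all_algebra.
From mathcomp Require Import all_classical all_reals all_analysis.
From mathcomp Require Import complex.
Set Implicit Arguments. Unset Strict Implicit. Unset Printing Implicit Defensive.
Import Order.TTheory GRing.Theory Num.Theory.
Import numFieldNormedType.Exports.
Local Open Scope classical_set_scope.
Local Open Scope ring_scope.
Local Open Scope complex_scope.

Section Defs.
Variable R : realType.
Local Notation mu := (@lebesgue_measure R).

Definition Gamma (x : R) : R :=
  Rintegral mu `]0%R, +oo[ (fun t => t `^ (x - 1) * expR (- t)).

Definition ml_coef (a : R) (n : nat) : R :=
  (Gamma (2 - a) ^+ n *
   \prod_(1 <= j < n.+1) (Gamma j.+1%:R / Gamma (j.+1%:R - a)))^-1.

Definition ML_partial (a : R) (d : nat) (M : 'M[R[i]]_d) (N : nat) : 'M[R[i]]_d :=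
  \sum_(n < N) ((ml_coef a n)%:C *: M ^+ n).

Definition ccvg (m n : nat) (u : nat -> 'M[R[i]]_(m, n)) : Prop :=
  forall i j, cvgn (fun k => complex.Re (u k i j)) /\ cvgn (fun k => complex.Im (u k i j)).

Definition clim (m n : nat) (u : nat -> 'M[R[i]]_(m, n)) : 'M[R[i]]_(m, n) :=
  \matrix_(i, j) (limn (fun k => complex.Re (u k i j)) +i* limn (fun k => complex.Im (u k i j))).

Definition ML (a : R) (d : nat) (M : 'M[R[i]]_d) : 'M[R[i]]_d :=
  clim (ML_partial a M).

Definition cint (d : nat) (D : set R) (f : R -> 'cV[R[i]]_d) : 'cV[R[i]]_d :=
  \col_i (Rintegral mu D (fun s => complex.Re (f s i 0)) +i*
          Rintegral mu D (fun s => complex.Im (f s i 0))).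

Definition cintegrable (d : nat) (D : set R) (f : R -> 'cV[R[i]]_d) : Prop :=
  forall i, mu.-integrable D (fun s => (complex.Re (f s i 0))%:E) /\
            mu.-integrable D (fun s => (complex.Im (f s i 0))%:E).

Definition ccont_on (d : nat) (T : R) (f : R -> 'cV[R[i]]_d) : Prop :=
  forall i, {within `[0, T], continuous (fun s => complex.Re (f s i 0))} /\
            {within `[0, T], continuous (fun s => complex.Im (f s i 0))}.

Definition Lkernel (a t s : R) : R := (t - s) `^ (a - 1) * s `^ (1 - a).

Definition LJ (a : R) (d : nat) (y : R -> 'cV[R[i]]_d) (t : R) : 'cV[R[i]]_d :=
  ((Gamma a * Gamma (2 - a))^-1)%:C *:
    cint `[0, t] (fun s => (Lkernel a t s)%:C *: y s).

Definition LJn (m : nat) (a : R) (d : nat) (y : R -> 'cV[R[i]]_d) : R -> 'cV[R[i]]_d :=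
  iter m (@LJ a d) y.

Definition LJ_partial (a : R) (d : nat) (A : 'M[R[i]]_d) (th : R -> 'cV[R[i]]_d)
  (t : R) (N : nat) : 'cV[R[i]]_d :=
  \sum_(j < N) (A ^+ j *m LJn j.+1 a th t).

Definition sol (a : R) (d : nat) (A : 'M[R[i]]_d) (th : R -> 'cV[R[i]]_d)
  (x0 : 'cV[R[i]]_d) (t : R) : 'cV[R[i]]_d :=
  ML a (t%:C *: A) *m x0 + clim (LJ_partial a A th t).

Definition cder (d : nat) (f : R -> 'cV[R[i]]_d) (t : R) : 'cV[R[i]]_d :=
  \col_i (derive1 (fun s => complex.Re (f s i 0)) t +i* derive1 (fun s => complex.Im (f s i 0)) t).

Definition rder0 (d : nat) (f : R -> 'cV[R[i]]_d) : 'cV[R[i]]_d :=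
  \col_i (lim ((fun h => h^-1 * (complex.Re (f h i 0) - complex.Re (f 0 i 0))) @ 0^'+) +i*
          lim ((fun h => h^-1 * (complex.Im (f h i 0) - complex.Im (f 0 i 0))) @ 0^'+)).

Definition cabs_cont (d : nat) (T : R) (f : R -> 'cV[R[i]]_d) : Prop :=
  cintegrable `[0, T] (cder f) /\
  forall t, 0 <= t <= T -> f t = f 0 + cint `[0, t] (cder f).

Definition caputo (a : R) (d : nat) (x : R -> 'cV[R[i]]_d) (t : R) : 'cV[R[i]]_d :=
  ((Gamma (1 - a))^-1)%:C *: cint `[0, t] (fun s => ((t - s) `^ (- a))%:C *: cder x s).

Definition LD (a : R) (d : nat) (x : R -> 'cV[R[i]]_d) (t : R) : 'cV[R[i]]_d :=
  if t == 0 then rder0 x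
  else (Gamma (2 - a) / t `^ (1 - a))%:C *: caputo a x t.

Definition cpser_on (d : nat) (T : R) (f : R -> 'cV[R[i]]_d) : Prop :=
  exists c : nat -> 'cV[R[i]]_d, forall t, 0 <= t <= T -> forall i,
    cvgn (series (fun n => Normc.normc (c n i 0) * t ^+ n)) /\
    complex.Re (f t i 0) = limn (series (fun n => complex.Re (c n i 0) * t ^+ n)) /\
    complex.Im (f t i 0) = limn (series (fun n => complex.Im (c n i 0) * t ^+ n)).

End Defs.

(* Main.v *)
Require Import Defs.
From HB Require Import structures.
From mathcomp Require Import all_boot all_order all_algebra.
From mathcomp Require Import all_classical all_reals all_analysis.
From mathcomp Require Import complex.
From mathcomp Require Import measurable_realfun.
From mathcomp Require Import ring lra.
Set Implicit Arguments.
Unset Strict Implicit.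
Unset Printing Implicit Defensive.
Import Order.TTheory GRing.Theory Num.Theory.
Import numFieldNormedType.Exports.
Local Open Scope classical_set_scope.
Local Open Scope ring_scope.
Local Open Scope complex_scope.

(* The L-integral maps s^n to beta_n t^(n+1), where beta_n is the ratio of consecutive coefficients of
   the Mittag-Leffler-type series (an Euler Beta integral). Hence the partial sums S_N of the
   two series are the Picard iterates S_(N+1) = x0 + LJ (A S_N + theta); as beta_n -> 0 they
   are dominated by a convergent numerical series, so they converge uniformly to x, and
   dominated convergence gives x = x0 + LJ (A x + theta).
   Put g = A x + theta. In the absolutely continuous case, associativity of convolution and
   the semigroup law of the power kernels show that the Riemann-Liouville integrals
   J^1 (J^(1-a) x') = J^(1-a) (x - x0) = J^(1-a) (LJ g) and a multiple of J^1 (s^(1-a) g)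
   coincide, and functions with equal primitives are equal almost everywhere.
   For power series everything is done termwise on (0, T]; at t = 0 the difference quotient
   of LJ g tends to g 0, since LJ 1 = t. *)

(** * Gamma and Beta integrals *)

(** [Gamma] is given only as an integral, so everything known about it here (finiteness, recursion,
    positivity, the Beta formula) is derived from Euler's product formula, proved in the extended
    reals before any finiteness is available. The L-kernel is homogeneous of degree 0: [s = t * u]
    makes it independent of [t]. This yields the continuity of L-integrals, and it also shows
    [beta_n -> 0] without asymptotics of Gamma, [beta_n] being up to a constant the n-th moment of
    the kernel on [[0, 1]]. In the absolutely continuous case [x'] is merely integrable, so its
    Caputo integral may diverge at some points and cannot be evaluated pointwise. Its primitive can:
    the convolutions of kernels [1 * k_(1-a)] and [k_(1-a) * k_a] are bounded on bounded intervals,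
    which is what Fubini needs. Integrals are real, the kernel is real, and a complex matrix acts by
    real linear combinations; hence the analysis is done on real and imaginary parts of
    components. *)

Section affine_change_of_variable.
Context {R : realType}.
Local Notation mu := (@lebesgue_measure R).
Implicit Types (c b : R) (f : R -> \bar R).

Lemma measurable_affine c b (D : set R) : measurable_fun D (fun x : R => c * x + b).
Proof.
by apply: measurable_funD => //; apply: measurable_funM.
Qed.

Section unique.
Variables (c b : R).
Hypothesis c0 : c != 0.
Let phi : measurableTypeR R -> measurableTypeR R := fun x => c * x + b.
Let mphi : measurable_fun [set: measurableTypeR R] phi.
Proof. exact: measurable_affine. Qed.
Let nu : {measure set (measurableTypeR R) -> \bar R} :=
  measure_function_pushforward__canonical__measure_function_Measure mu mphi.
Let abs_c : {nonneg R} := NngNum (normr_ge0 c).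

(** Uniqueness of Lebesgue measure reduces the claim to the intervals []p, q]]. The sign of [c]
    decides which end of the preimage is closed; its length is [(q - p) / |c|] either way. *)
Lemma lebesgue_measure_affine (A : set (measurableTypeR R)) : measurable A ->
  mu A = mscale abs_c nu A.
Proof.
move=> mA; apply: lebesgue_measure_unique => // _ [[p q]/= _ <-].
rewrite /mscale /= /pushforward.
have [cp|cn|c00] := ltgtP 0 c; last by move: c0; rewrite -c00 eqxx.
- have -> : phi @^-1` `]p, q] = `](p - b) / c, (q - b) / c]%classic.
    apply/seteqP; split => x /=; rewrite !in_itv/= ltr_pdivrMr// ler_pdivlMr//
      /phi (mulrC x) ltrBlDr lerBrDr//.
  rewrite !lebesgue_measure_itv/= !lte_fin ltr_pM2r ?invr_gt0// ltrD2r.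
  case: ifP => pq; last by rewrite mule0.
  rewrite -!EFinB -EFinM gtr0_norm// -mulrBl opprB addrA addrNK.
  by rewrite mulrC divfK.
- have -> : phi @^-1` `]p, q] = `[(q - b) / c, (p - b) / c[%classic.
    apply/seteqP; split => x /=; rewrite !in_itv/= ltr_ndivlMr// ler_ndivrMr//
      /phi (mulrC x) ltrBlDr lerBrDr// andbC//.
  rewrite !lebesgue_measure_itv/= !lte_fin ltr_nM2r ?invr_lt0// ltrD2r.
  case: ifP => pq; last by rewrite mule0.
  rewrite -!EFinB -EFinM ltr0_norm// -mulrBl opprB addrA addrNK.
  rewrite -(opprB q p) !mulNr mulrN opprK mulrCA mulfV ?mulr1 ?opprB//.
Qed.

Lemma ge0_integral_affine f : measurable_fun setT f -> (forall x, 0 <= f x)%E ->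
  (\int[mu]_x f x = `|c|%:E * \int[mu]_x f (c * x + b)%R)%E.
Proof.
move=> mf f0.
rewrite (@eq_measure_integral _ _ _ _ (mscale abs_c nu)) =>[|A mA _]; last first.
  exact: lebesgue_measure_affine.
rewrite ge0_integral_mscale//; congr (_ * _)%E.
by rewrite ge0_integral_pushforward.
Qed.

Lemma integral_affine f : measurable_fun setT f ->
  (\int[mu]_x f x = `|c|%:E * \int[mu]_x f (c * x + b)%R)%E.
Proof.
move=> mf; rewrite integralE [in RHS]integralE.
rewrite ge0_integral_affine//; last exact: measurable_funepos.
rewrite [X in (_ - X)%E]ge0_integral_affine//; last exact: measurable_funeneg.
pose A := (\int[mu]_x f^\+ (c * x + b)%R)%E.
pose B := (\int[mu]_x f^\- (c * x + b)%R)%E.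
have A0 : (0 <= A)%E by apply: integral_ge0.
have B0 : (0 <= B)%E by apply: integral_ge0.
have -> : (\int[mu]_x (fun x => f (c * x + b)%R)^\+ x = A)%E.
  by apply: eq_integral => x _; rewrite [LHS]funeposE /A funeposE.
have -> : (\int[mu]_x (fun x => f (c * x + b)%R)^\- x = B)%E.
  by apply: eq_integral => x _; rewrite [LHS]funenegE /A funenegE.
rewrite -/A -/B; move: A B A0 B0.
have cc : 0 < `|c| by rewrite normr_gt0.
(* Without integrability [A - B] may involve infinities, where distributivity has to be checked case
   by case. *)
move=> [A||] [B||]//= A0 B0;
  rewrite ?(gt0_muley, gt0_muleNy, lte_fin)//= -?EFinM -?EFinN -?EFinD -?EFinM
   ?(gt0_muley, gt0_muleNy, lte_fin)//.
by rewrite mulrBr.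
Qed.

End unique.

Lemma integral_scale_itv (c : R) (f : R -> R) (g : R -> R) : 0 < c ->
  measurable_fun `[0, c] f -> {in `[0, 1], forall u, g u = f (c * u)} ->
  (\int[mu]_(s in `[0%R, c]) (f s)%:E = c%:E * \int[mu]_(u in `[0%R, 1%R]) (g u)%:E)%E.
Proof.
move=> c0 mf fg.
rewrite integral_mkcond (@integral_affine c 0) ?gt_eqF//; last first.
  by apply/(measurable_restrictT _ _).1 => //; exact/measurable_EFinP.
rewrite gtr0_norm// [in RHS]integral_mkcond; congr (_ * _)%E.
apply: eq_integral => x _; rewrite addr0 !patchE.
have -> : (c * x \in `[0, c]%classic) = (x \in `[0, 1]%classic).
  rewrite !mem_setE !in_itv/= pmulr_rge0//; congr (_ && _).
  by rewrite -[leRHS]mulr1 ler_pM2l.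
by case: ifPn => // ; rewrite mem_setE => /fg ->.
Qed.

End affine_change_of_variable.

(** * Euler's Beta formula and the basic properties of Gamma *)

Section gamma_beta.
Context {R : realType}.
Local Notation mu := (@lebesgue_measure R).
Implicit Types p q t x : R.

(* Extending the integrands by 0 turns Euler's product formula into Tonelli on the plane. *)
Definition gamma_pdf p x : R := if 0 < x then x `^ (p - 1) * expR (- x) else 0.
Definition beta_ker p q t x : R :=
  if 0 < x < t then (t - x) `^ (p - 1) * x `^ (q - 1) else 0.
(** Valued in the extended reals, so that Tonelli applies for all parameters; finiteness for [0 < p]
    is a consequence. *)
Definition gammaE p : \bar R := (\int[mu]_x (gamma_pdf p x)%:E)%E.
Definition betaE p q t : \bar R := (\int[mu]_x (beta_ker p q t x)%:E)%E.

Lemma gamma_pdf_ge0 p x : 0 <= gamma_pdf p x.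
Proof. by rewrite /gamma_pdf; case: ifP => // _; rewrite mulr_ge0 ?powR_ge0 ?expR_ge0. Qed.

Lemma beta_ker_ge0 p q t x : 0 <= beta_ker p q t x.
Proof. by rewrite /beta_ker; case: ifP => // _; rewrite mulr_ge0 ?powR_ge0. Qed.

Lemma gamma_pdf_patch p :
  gamma_pdf p = (fun x => x `^ (p - 1) * expR (- x)) \_ `]0, +oo[.
Proof.
apply/funext => x; rewrite patchE /gamma_pdf.
by rewrite mem_setE in_itv/= andbT.
Qed.

Lemma beta_ker_patch p q t :
  beta_ker p q t = (fun x => (t - x) `^ (p - 1) * x `^ (q - 1)) \_ `]0, t[.
Proof.
apply/funext => x; rewrite patchE /beta_ker.
by rewrite mem_setE in_itv.
Qed.

Lemma measurable_powRB q t (D : set R) : measurable_fun D (fun x => (t - x) `^ q).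
Proof.
apply: measurable_funTS; apply: (measurableT_comp (measurable_powR _)).
exact: measurable_funB.
Qed.

Lemma measurable_beta_ker p q t : measurable_fun setT (beta_ker p q t).
Proof.
rewrite beta_ker_patch; apply/(measurable_restrictT _ _).1 => //.
apply: measurable_funM; first exact: measurable_powRB.
exact: measurable_funTS.
Qed.

Lemma measurable_expRN (D : set R) : measurable_fun D (fun x => expR (- x)).
Proof.
apply: measurable_funTS; apply: (measurable_comp (F := setT)) => //.
Qed.

Lemma measurable_gamma_pdf p : measurable_fun setT (gamma_pdf p).
Proof.
rewrite gamma_pdf_patch; apply/(measurable_restrictT _ _).1 => //.
apply: measurable_funM; first exact: measurable_funTS.
exact: measurable_expRN.
Qed.

Lemma measurable_EFin_beta_ker p q t :
  measurable_fun setT (fun x => (beta_ker p q t x)%:E).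
Proof. by apply/measurable_EFinP; exact: measurable_beta_ker. Qed.

Lemma measurable_EFin_gamma_pdf p :
  measurable_fun setT (fun x => (gamma_pdf p x)%:E).
Proof. by apply/measurable_EFinP; exact: measurable_gamma_pdf. Qed.

Lemma gammaEE p : gammaE p =
  (\int[mu]_(x in `]0%R, +oo[) (x `^ (p - 1) * expR (- x))%:E)%E.
Proof.
rewrite /gammaE [RHS]integral_mkcond; apply: eq_integral => x _.
by rewrite gamma_pdf_patch restrict_EFin.
Qed.

Lemma gammaE_ge0 p : (0 <= gammaE p)%E.
Proof. by apply: integral_ge0 => x _; rewrite lee_fin gamma_pdf_ge0. Qed.

Lemma betaE_ge0 p q t : (0 <= betaE p q t)%E.
Proof. by apply: integral_ge0 => x _; rewrite lee_fin beta_ker_ge0. Qed.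

Lemma fine_gammaE p : fine (gammaE p) = Gamma p.
Proof. by rewrite gammaEE. Qed.

(** Substitution [x = t * u]: the two factors of the kernel give [t ^ (p - 1)] and [t ^ (q - 1)],
    the Jacobian one more [t]. *)
Lemma betaE_scale p q t : 0 < t -> betaE p q t = ((t `^ (p + q - 1))%:E * betaE p q 1)%E.
Proof.
move=> t0; have t0' : t != 0 by rewrite gt_eqF.
have k0 x : (0 <= (beta_ker p q t x)%:E)%E by rewrite lee_fin beta_ker_ge0.
rewrite /betaE (ge0_integral_affine 0 t0' (measurable_EFin_beta_ker p q t) k0).
have -> : (\int[mu]_x (beta_ker p q t (t * x + 0))%:E =
    \int[mu]_x ((t `^ (p - 1) * t `^ (q - 1))%:E * (beta_ker p q 1 x)%:E))%E.
  apply: eq_integral => x _; rewrite -!EFinM; congr EFin.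
  have xt : (t * x < t) = (x < 1) by rewrite -[X in _ < X]mulr1 ltr_pM2l.
  rewrite addr0 /beta_ker pmulr_rgt0// xt.
  case: ifPn => [/andP[x0 x1]|]; last by rewrite !mulr0.
  rewrite -{1}[t]mulr1 -mulrBr !powRM ?(ltW t0) ?subr_ge0 ?(ltW x0) ?(ltW x1)//.
  by rewrite mulrACA.
have k1 x : setT x -> (0 <= (beta_ker p q 1 x)%:E)%E.
  by move=> _; rewrite lee_fin beta_ker_ge0.
have tt : 0 <= t `^ (p - 1) * t `^ (q - 1) by rewrite mulr_ge0 ?powR_ge0.
rewrite (ge0_integralZl_EFin mu measurableT k1 (measurable_EFin_beta_ker p q 1) tt).
rewrite muleA -EFinM gtr0_norm// (_ : p + q - 1 = 1 + (p - 1) + (q - 1)); last by ring.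
have tD r u : t `^ (r + u) = t `^ r * t `^ u by rewrite powRD// t0' implybT.
by rewrite !(tD, powRr1 (ltW t0)) !mulrA.
Qed.

(** The function [F (x, y) = gamma_pdf q x * gamma_pdf p (y - x)] is integrated over the plane in
    both orders. With [y] innermost, translation invariance gives the product of Gamma integrals.
    With [x] innermost, the exponentials combine to [expR (- y)] and leave [betaE p q y], which
    scales as a power of [y]. *)
Lemma gammaE_mul p q : (gammaE p * gammaE q = betaE p q 1 * gammaE (p + q))%E.
Proof.
pose F (z : R * R) : \bar R := (gamma_pdf q z.1 * gamma_pdf p (z.2 - z.1))%:E.
have mF : measurable_fun [set: R * R] F.
  apply/measurable_EFinP; apply: measurable_funM.
    by apply: (measurableT_comp (measurable_gamma_pdf _)).
  apply: (measurableT_comp (measurable_gamma_pdf _)).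
  exact: measurable_funB.
have F0 z : (0 <= F z)%E by rewrite lee_fin mulr_ge0// gamma_pdf_ge0.
have := @fubini_tonelli _ _ _ _ R mu mu F mF F0.
have -> : (\int[mu]_x \int[mu]_y F (x, y) = gammaE p * gammaE q)%E.
  rewrite -ge0_integralZl//; last 3 first.
  - exact: measurable_EFin_gamma_pdf.
  - by move=> x _; rewrite lee_fin gamma_pdf_ge0.
  - exact: gammaE_ge0.
  apply: eq_integral => x _; rewrite /F/=.
  under eq_integral do rewrite EFinM.
  rewrite ge0_integralZl_EFin ?gamma_pdf_ge0//; last 2 first.
  - by move=> y _; rewrite lee_fin gamma_pdf_ge0.
  - apply/measurable_EFinP; apply: (measurableT_comp (measurable_gamma_pdf _)).
    exact: measurable_funB.
  rewrite muleC; congr (_ * _)%E.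
  rewrite /gammaE (@ge0_integral_affine _ 1 (- x)) ?oner_eq0//; last 2 first.
  - exact: measurable_EFin_gamma_pdf.
  - by move=> y; rewrite lee_fin gamma_pdf_ge0.
  by rewrite normr1 mul1e; apply: eq_integral => y _; rewrite mul1r.
move=> ->; rewrite -ge0_integralZl//; last 3 first.
- exact: measurable_EFin_gamma_pdf.
- by move=> x _; rewrite lee_fin gamma_pdf_ge0.
- exact: betaE_ge0.
apply: eq_integral => u _; rewrite /F/=.
have [u0|u0] := ltP 0 u; last first.
  rewrite [X in (_ * X%:E)%E]/gamma_pdf ltNge u0/= mule0 integral0_eq// => s _.
  rewrite /gamma_pdf; case: ifP => s0; last by rewrite mul0r.
  by rewrite ifF ?mulr0// subr_gt0; apply/negbTE; rewrite -leNgt (le_trans u0)// ltW.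
rewrite [X in (_ * X%:E)%E]/gamma_pdf u0 EFinM muleA (muleC (betaE _ _ _)) -betaE_scale//.
rewrite muleC /betaE -ge0_integralZl_EFin ?expR_ge0//; last 2 first.
- by move=> x _; rewrite lee_fin beta_ker_ge0.
- exact: measurable_EFin_beta_ker.
apply: eq_integral => s _; rewrite -EFinM; congr EFin.
rewrite /gamma_pdf /beta_ker subr_gt0; case: ifP => s0/=; last by rewrite mul0r mulr0.
case: ifP => su; last by rewrite !mulr0.
rewrite (_ : - u = - s - (u - s)); last by ring.
rewrite expRD; ring.
Qed.

(** For [q < 1] the integrand is unbounded at 0. The fundamental theorem of calculus is therefore
    used on [[1 / (n + 2), 1]], nondegenerate already for [n = 0], and monotone convergence exhausts
    []0, 1]]. *)
Lemma betaE1 q : 0 < q -> betaE 1 q 1 = (q^-1)%:E.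
Proof.
move=> q0.
pose f x : \bar R := (x `^ (q - 1))%:E.
pose F (n : nat) : set R := `[n.+2%:R^-1, 1]%classic.
have mf (D : set R) : measurable_fun D f by apply/measurable_EFinP; exact: measurable_funTS.
have -> : betaE 1 q 1 = (\int[mu]_(x in `]0%R, 1%R]) f x)%E.
  rewrite -(integral_itv_bndo_bndc (mf _)).
  rewrite [RHS]integral_mkcond /betaE; apply: eq_integral => x _.
  rewrite patchE mem_setE in_itv/= /beta_ker /f; case: ifP => // _.
  by rewrite subrr powRr0 mul1r.
have -> : `]0%R, 1%R]%classic = \bigcup_i F i.
  apply/seteqP; split => [x/= |x [n _]]; rewrite /F/= !in_itv/=; last first.
    by move=> /andP[nx ->]; rewrite (lt_le_trans _ nx)// invr_gt0 ltr0n.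
  move=> /andP[x0 x1].
  exists (Num.truncn x^-1) => //=; rewrite in_itv/= x1 andbT invf_ple ?posrE ?ltr0n//.
  have /ltW := truncnS_gt x^-1.
  by move=> /le_trans; apply; rewrite ler_nat.
have -> : q^-1%:E = limn (fun i => \int[mu]_(x in F i) f x)%E.
  apply/esym/cvg_lim => //.
  rewrite (_ : (fun i => _) = fun i => (q^-1 - q^-1 * i.+2%:R^-1 `^ q)%:E); last first.
    apply/funext => i.
    have i1 : i.+2%:R^-1 < 1 :> R by rewrite invf_lt1 ?ltr0n// ltr1n.
    have i0 : 0 < i.+2%:R^-1 :> R by rewrite invr_gt0 ltr0n.
    have dF x : 0 < x -> is_derive x 1 (fun x : R => q^-1 * x `^ q) (x `^ (q - 1)).
      move=> x0; have := is_deriveZ q^-1 (is_derive1_powR q x0).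
      have -> // : q^-1 *: (q * x `^ (q - 1)) = x `^ (q - 1).
      by rewrite /GRing.scale/= mulrA mulVf ?mul1r// gt_eqF.
    rewrite /F /f (@continuous_FTC2 _ _ (fun x => q^-1 * x `^ q))//.
    - by rewrite powR1 mulr1.
    - apply: continuous_in_subspaceT => x; rewrite inE/= in_itv/= => /andP[ix _].
      apply: differentiable_continuous; apply/derivable1_diffP.
      by apply: derivable_powR; rewrite in_itv/= andbT (lt_le_trans i0).
    - have cF x : 0 < x -> {for x, continuous (fun x : R => q^-1 * x `^ q)}.
        by move=> /dF[d _]; apply: differentiable_continuous; apply/derivable1_diffP.
      split.
      + by move=> x; rewrite in_itv/= => /andP[ix _]; have [] := dF _ (lt_trans i0 ix).
      + by apply: cvg_at_right_filter; apply: cF.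
      + by apply: cvg_at_left_filter; apply: cF.
    - move=> x; rewrite in_itv/= => /andP[ix _].
      by rewrite derive1E; have [_ ->] := dF _ (lt_trans i0 ix).
  apply: cvg_EFin; first exact: nearW.
  rewrite -[X in _ --> X]subr0; apply: cvgB; first exact: cvg_cst.
  rewrite -(mulr0 q^-1); apply: cvgMr.
  apply: (@cvg_comp _ _ _ (fun i : nat => i.+2%:R^-1) (fun x : R => x `^ q) _ (0^'+)); last exact: powR_cvg0.
  move=> U [r /= r0 rU]; near=> i; apply: rU => /=; last by rewrite invr_gt0 ltr0n.
  rewrite sub0r normrN ger0_norm ?invr_ge0//.
  apply: (@le_lt_trans _ _ i.+1%:R^-1); first by rewrite lef_pV2 ?posrE ?ltr0n// ler_nat.
  by near: i; exact: (near_infty_natSinv_lt (PosNum r0)).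
apply/esym/cvg_lim => //; apply: ge0_nondecreasing_set_cvg_integral.
- apply/nondecreasing_seqP => i; rewrite subsetEset => x; rewrite /F/= !in_itv/=.
  move=> /andP[ix ->]; rewrite andbT (le_trans _ ix)// lef_pV2 ?posrE ?ltr0n//.
  by rewrite ler_nat.
- by move=> i; exact: measurable_itv.
- by move=> i; exact: mf.
- by move=> i x _; rewrite lee_fin powR_ge0.
Unshelve. all: by end_near. Qed.

Lemma gammaE1 : gammaE 1 = 1%E.
Proof.
rewrite gammaEE integral_itv_obnd_cbnd; last first.
  apply/measurable_EFinP/measurable_funTS/measurable_funM; first exact: measurable_powR.
  exact: measurable_expRN.
rewrite -(@integral_exponential_pdf R 1)// [LHS]integral_mkcond.
apply: eq_integral => x _; rewrite /exponential_pdf restrict_EFin; congr (_ _ x).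
by apply/eq_restrictP => y _; rewrite subrr powRr0 !mul1r mulN1r.
Qed.

(** Euler's product formula with first parameter 1, where the Beta integral is elementary, replaces
    integration by parts. *)
Lemma gammaE_rec q : 0 < q -> gammaE q = ((q^-1)%:E * gammaE (q + 1))%E.
Proof.
by move=> q0; rewrite addrC -betaE1// -gammaE_mul gammaE1 mul1e.
Qed.

Lemma gammaE_nat n : (gammaE n.+1%:R < +oo)%E.
Proof.
elim: n => [|n IHn]; first by rewrite gammaE1 ltry.
move: IHn; rewrite gammaE_rec ?ltr0n// -natr1.
have := gammaE_ge0 (n.+1%:R + 1 : R); rewrite -[n.+2%:R]natr1 -natr1.
by case: (gammaE _) => [r||]//= _; rewrite ?ltry// gt0_muley// lte_fin invr_gt0 natr1 ltr0n.
Qed.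

(** The recursion moves the argument to [p + 1], where the power in the integrand has the positive
    exponent [p]. It is at most 1 for [x <= 1] and at most [x ^ n] for [x > 1], with an integer
    [n > p]; this leaves Gamma integrals at positive integers. *)
Lemma gammaE_lty p : 0 < p -> (gammaE p < +oo)%E.
Proof.
move=> p0; rewrite gammaE_rec//.
suff : (gammaE (p + 1) < +oo)%E.
  have := gammaE_ge0 (p + 1).
  by case: (gammaE _) => [r||]//= _ _; rewrite -EFinM ltry.
set n := (Num.truncn p).+1.
apply: (@le_lt_trans _ _ (gammaE 1%:R + gammaE n.+1%:R)%E); last by rewrite lte_add_pinfty// gammaE_nat.
rewrite /gammaE -ge0_integralD//; last 4 first.
- by move=> x _; rewrite lee_fin gamma_pdf_ge0.
- exact: measurable_EFin_gamma_pdf.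
- by move=> x _; rewrite lee_fin gamma_pdf_ge0.
- exact: measurable_EFin_gamma_pdf.
apply: ge0_le_integral => //.
- by move=> x _; rewrite lee_fin gamma_pdf_ge0.
- exact: measurable_EFin_gamma_pdf.
- by apply: emeasurable_funD; exact: measurable_EFin_gamma_pdf.
move=> x _; rewrite -EFinD lee_fin /gamma_pdf; case: ifP => x0; last by rewrite addr0.
rewrite -mulrDl ler_pM2r ?expR_gt0// addrK subrr powRr0 -natr1 addrK.
have [x1|x1] := leP x 1.
  rewrite (@le_trans _ _ 1)// ?lerDl ?powR_ge0//.
  rewrite -[leRHS](powRr0 x); apply: ger_powR; rewrite ?x0//; exact: ltW.
rewrite (@le_trans _ _ (x `^ n%:R))// ?lerDr//.
by apply: ler_powR; rewrite ?(ltW x1)// ltW// truncnS_gt.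
Qed.

Lemma gammaE_Gamma p : 0 < p -> gammaE p = (Gamma p)%:E.
Proof. by move=> p0; rewrite -fine_gammaE fineK// ge0_fin_numE ?gammaE_ge0 ?gammaE_lty. Qed.

Lemma Gamma1 : Gamma 1 = 1 :> R.
Proof. by rewrite -fine_gammaE gammaE1. Qed.

Lemma GammaD1 p : 0 < p -> Gamma (p + 1) = p * Gamma p.
Proof.
move=> p0; have := gammaE_rec p0; rewrite !gammaE_Gamma ?addr_gt0// -EFinM => -[->].
by rewrite mulrA divff ?mul1r// gt_eqF.
Qed.

(** A vanishing integral would force the integrand, positive on all of []0, +oo[], to be zero almost
    everywhere there. *)
Lemma Gamma_gt0 p : 0 < p -> 0 < Gamma p.
Proof.
move=> p0; rewrite -lte_fin -gammaE_Gamma// lt_neqAle gammaE_ge0 andbT eq_sym.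
apply/negP => /eqP; rewrite gammaEE => h0.
have := @ae_eq_integral_abs _ _ R mu `]0%R, +oo[%classic _ (fun x => (x `^ (p - 1) * expR (- x))%:E).
case=> //.
  apply/measurable_EFinP/measurable_funTS/measurable_funM; first exact: measurable_powR.
  exact: measurable_expRN.
move=> + _; case.
  rewrite -[RHS]h0; apply: eq_integral => x _.
  by rewrite gee0_abs// lee_fin mulr_ge0 ?powR_ge0 ?expR_ge0.
move=> N [mN N0 sN].
have : (mu `]0%R, +oo[%classic <= mu N)%E.
  apply: le_measure; rewrite ?inE// => x/= x0; apply: sN => /= /(_ x0) [].
  move/eqP; rewrite mulf_eq0 powR_eq0 expR_eq0 orbF.
  by move: x0; rewrite in_itv/= andbT => x0; rewrite gt_eqF.
by rewrite N0 lebesgue_measure_itv/= lt0y.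
Qed.

(** An infinite Beta integral is excluded by Euler's formula itself: the Gamma factors are finite,
    and [Gamma (p + q)] is positive. *)
Lemma betaE_Gamma p q : 0 < p -> 0 < q ->
  betaE p q 1 = (Gamma p * Gamma q / Gamma (p + q))%:E.
Proof.
move=> p0 q0; have := gammaE_mul p q; rewrite !gammaE_Gamma ?addr_gt0//.
have := Gamma_gt0 (addr_gt0 p0 q0) => G0.
have := betaE_ge0 p q 1; case: (betaE p q 1) => [r||]//= _.
  by rewrite -!EFinM => -[->]; rewrite mulfK// gt_eqF.
by rewrite gt0_mulye// lte_fin.
Qed.

Lemma betaE_GammaE p q t : 0 < p -> 0 < q -> 0 < t ->
  betaE p q t = (t `^ (p + q - 1) * (Gamma p * Gamma q / Gamma (p + q)))%:E.
Proof. by move=> p0 q0 t0; rewrite betaE_scale// betaE_Gamma. Qed.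

End gamma_beta.

#[local] Opaque Gamma.

(** * The scalar L-fractional integral *)

Section L_kernel.
Context {R : realType}.
Local Notation mu := (@lebesgue_measure R).
Variable a : R.
Hypothesis a01 : 0 < a < 1.
Implicit Types (s t T : R) (y f g : R -> R).

Let a0 : 0 < a. Proof. by case/andP: a01. Qed.
Let a1 : a < 1. Proof. by case/andP: a01. Qed.

Lemma Lkernel_ge0 t s : 0 <= Lkernel a t s.
Proof. by rewrite mulr_ge0 ?powR_ge0. Qed.

Lemma measurable_Lkernel t (D : set R) : measurable_fun D (Lkernel a t).
Proof.
by apply: measurable_funM; [exact: measurable_powRB|exact: measurable_funTS].
Qed.

(** Only the open interval is constrained: at the end points, which are negligible, a power with
    base 0 and negative exponent has a conventional value. *)
Lemma integral_eq_beta_ker p q t (f : R -> R) : measurable_fun `]0, t[ f ->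
  {in `]0, t[, forall s, f s = (t - s) `^ (p - 1) * s `^ (q - 1)} ->
  (\int[mu]_(s in `[0%R, t]) (f s)%:E = betaE p q t)%E.
Proof.
move=> mf fE; rewrite (@integral_itv_bndoo R 0 t (EFin \o f)); last exact/measurable_EFinP.
rewrite integral_mkcond; apply: eq_integral => s _.
rewrite patchE mem_setE /beta_ker; case: ifPn => [st|].
  by rewrite /= fE//; move: st; rewrite in_itv/= => ->.
by rewrite in_itv/= => /negbTE ->.
Qed.

Definition L_beta n : R := Gamma (n%:R + 2 - a) / (Gamma n.+2%:R * Gamma (2 - a)).

Let na0 n : 0 < n%:R + 2 - a.
Proof. by have : 0 <= n%:R :> R by []; have := a1; lra. Qed.

(** The integrand is the Beta kernel with parameters [a] and [n + 2 - a], whose sum is the integer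
    [n + 2]. *)
Lemma integral_LkernelXn n t : 0 < t ->
  (\int[mu]_(s in `[0%R, t]) (Lkernel a t s * s ^+ n)%:E =
   (t ^+ n.+1 * (Gamma a * Gamma (n%:R + 2 - a) / Gamma n.+2%:R))%:E)%E.
Proof.
move=> t0; rewrite (@integral_eq_beta_ker a (n%:R + 2 - a)).
- rewrite (betaE_GammaE a0 (na0 n) t0).
  have -> : a + (n%:R + 2 - a) = n.+2%:R by rewrite -addn2 natrD; ring.
  have -> : n.+2%:R - 1 = n.+1%:R :> R by rewrite -[n.+2%:R]natr1 addrK.
  by rewrite powR_mulrn// ltW.
- by apply: measurable_funM; [exact: measurable_Lkernel|exact: measurable_funTS].
- move=> s; rewrite in_itv/= => /andP[s0 st].
  rewrite /Lkernel -mulrA -powR_mulrn; last exact: ltW.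
  rewrite -powRD; last by rewrite (gt_eqF s0) implybT.
  by congr (_ * _ `^ _); ring.
Qed.

Lemma integral_Lkernel t : 0 < t ->
  (\int[mu]_(s in `[0%R, t]) (Lkernel a t s)%:E = (t * (Gamma a * Gamma (2 - a)))%:E)%E.
Proof.
move=> t0; have := integral_LkernelXn 0 t0; rewrite add0r expr1.
rewrite -[2%:R]natr1 GammaD1// Gamma1 mulr1 divr1 => <-.
by apply: eq_integral => s _; rewrite expr0 mulr1.
Qed.

Lemma integrable_Lkernel t : mu.-integrable `[0, t] (EFin \o Lkernel a t).
Proof.
apply/integrableP; split; first by apply/measurable_EFinP; exact: measurable_Lkernel.
have [t0|t0] := ltP 0 t.
  under eq_integral do rewrite /= ger0_norm ?Lkernel_ge0//.
  by rewrite integral_Lkernel// ltry.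
move: t0; rewrite le_eqVlt => /orP[/eqP ->|t0]; first by rewrite set_itv1 integral_set1 ltry.
by rewrite set_itv_ge ?bnd_simp -?ltNge// integral_set0 ltry.
Qed.

Lemma within_continuous_sub T t y : t <= T ->
  {within `[0, T], continuous y} -> {within `[0, t], continuous y}.
Proof.
move=> tT; apply: continuous_subspaceW => x/=; rewrite !in_itv/= => /andP[->].
by move=> /le_trans; apply.
Qed.

Lemma within_continuous_measurable T y :
  {within `[0, T], continuous y} -> measurable_fun `[0, T] y.
Proof. exact: subspace_continuous_measurable_fun. Qed.

Lemma within_continuous_bounded T y : {within `[0, T], continuous y} ->
  exists2 M, 0 < M & {in `[0, T], forall s, `|y s| <= M}.
Proof.
move=> cy; have := continuous_compact cy (@segment_compact _ 0 T).
move=> /compact_bounded[M [_ HM]].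
exists (Num.max (M + 1) 1); first by rewrite lt_max ltr01 orbT.
move=> s sT; apply: HM; last by exists s.
by rewrite lt_max ltrDl ltr01.
Qed.

Lemma integrable_bounded_Lkernel t y M : measurable_fun `[0, t] y ->
  {in `[0, t], forall s, `|y s| <= M} ->
  mu.-integrable `[0, t] (fun s => (Lkernel a t s * y s)%:E).
Proof.
move=> my yM.
have -> : (fun s => (Lkernel a t s * y s)%:E) = ((EFin \o Lkernel a t) \* (EFin \o y))%E.
  by apply/funext => s /=; rewrite EFinM.
apply: integrableMl => //; first exact: integrable_Lkernel.
exists M; split; first exact: num_real.
by move=> N MN s/= st; exact: le_trans (yM _ st) (ltW MN).
Qed.

Lemma integrable_Lkernel_continuous t T y : t <= T ->
  {within `[0, T], continuous y} ->
  mu.-integrable `[0, t] (fun s => (Lkernel a t s * y s)%:E).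
Proof.
move=> tT /(within_continuous_sub tT) cy.
have [M _ yM] := within_continuous_bounded cy.
exact: integrable_bounded_Lkernel (within_continuous_measurable cy) yM.
Qed.

(** The action of [LJ] on one real or imaginary part of one component. *)
Definition RLJ y t : R :=
  (Gamma a * Gamma (2 - a))^-1 * \int[mu]_(s in `[0, t]) (Lkernel a t s * y s).

Let cL0 : 0 < Gamma a * Gamma (2 - a).
Proof. by rewrite mulr_gt0// Gamma_gt0//; have := a1; lra. Qed.

Lemma L_beta_gt0 n : 0 < L_beta n.
Proof.
apply: divr_gt0; first exact: Gamma_gt0 (na0 n).
apply: mulr_gt0; first exact/Gamma_gt0.
by apply: Gamma_gt0; have := a1; lra.
Qed.

Lemma eq_RLJ t f g : {in `[0, t], f =1 g} -> RLJ f t = RLJ g t.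
Proof.
move=> fg; congr (_ * _); apply: eq_Rintegral => s /[1!inE]/= st.
by rewrite fg.
Qed.

Lemma RLJXn n t : 0 <= t -> RLJ (fun s => s ^+ n) t = L_beta n * t ^+ n.+1.
Proof.
rewrite le_eqVlt => /orP[/eqP <-|t0].
  by rewrite expr0n mulr0 /RLJ set_itv1 Rintegral_set1 mulr0.
rewrite /RLJ /Rintegral integral_LkernelXn//= /L_beta.
have : Gamma (2 - a) != 0 by rewrite gt_eqF// Gamma_gt0//; have := a1; lra.
have : Gamma a != 0 by rewrite gt_eqF// Gamma_gt0.
have : Gamma n.+2%:R != 0 :> R by rewrite gt_eqF// Gamma_gt0.
move: (Gamma _) (Gamma _) (Gamma _) (Gamma _) => A B C D C0 B0 D0.
by field; rewrite C0 B0 D0.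
Qed.

(** Positivity of the kernel carries a monomial bound through the integral at the cost of one factor
    [L_beta n]. Iterated from [n = 0], these factors multiply up to the coefficients of the
    Mittag-Leffler-type series. *)
Lemma RLJ_le t y M n : 0 <= t -> 0 <= M -> measurable_fun `[0, t] y ->
  {in `[0, t], forall s, `|y s| <= M * s ^+ n} ->
  `|RLJ y t| <= M * (L_beta n * t ^+ n.+1).
Proof.
move=> t0 M0 my yM.
have cn : {within `[0, t], continuous (fun s : R => M * s ^+ n)}.
  apply: continuous_subspaceT => s; apply: cvgM; [exact: cvg_cst|exact: exprn_continuous].
have iy : mu.-integrable `[0, t] (fun s => (Lkernel a t s * y s)%:E).
  apply: (@integrable_bounded_Lkernel _ _ (M * t ^+ n)) => // s st.
  rewrite (le_trans (yM _ st))// ler_wpM2l//.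
  by move: st; rewrite in_itv/= => /andP[s0 st]; rewrite lerXn2r.
have i2 := integrable_Lkernel_continuous (lexx t) cn.
rewrite -RLJXn// /RLJ normrM gtr0_norm ?invr_gt0// mulrCA.
rewrite ler_pM2l ?invr_gt0//.
apply: (le_trans (le_normr_Rintegral _ _)) => //.
have i3 := integrable_Lkernel_continuous (lexx t)
  (continuous_subspaceT (@exprn_continuous R n)).
rewrite -RintegralZl//; apply: le_Rintegral => //.
- exact: (integrable_norm iy).
- under [X in _.-integrable _ X]eq_fun do rewrite mulrCA; exact: i2.
move=> s st; rewrite normrM (ger0_norm (Lkernel_ge0 _ _)) mulrCA.
by rewrite ler_wpM2l ?Lkernel_ge0// yM.
Qed.

Lemma L_beta0 : L_beta 0 = 1.
Proof.
rewrite /L_beta add0r -[2%:R]natr1 GammaD1// Gamma1 !mul1r divff//.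
by rewrite gt_eqF// Gamma_gt0//; have := a1; lra.
Qed.

Lemma RLJ_le0 t y M : 0 <= t -> 0 <= M -> measurable_fun `[0, t] y ->
  {in `[0, t], forall s, `|y s| <= M} -> `|RLJ y t| <= M * t.
Proof.
move=> t0 M0 my yM; have := @RLJ_le t y M 0 t0 M0 my.
by rewrite L_beta0 mul1r expr1; apply => s st; rewrite expr0 mulr1 yM.
Qed.

Lemma RLJD T t f g : t <= T -> {within `[0, T], continuous f} ->
  {within `[0, T], continuous g} ->
  RLJ (fun s => f s + g s) t = RLJ f t + RLJ g t.
Proof.
move=> tT cf cg; rewrite /RLJ -mulrDr -RintegralD//.
- by congr (_ * _); apply: eq_Rintegral => s _; rewrite mulrDr.
- exact: integrable_Lkernel_continuous cf.
- exact: integrable_Lkernel_continuous cg.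
Qed.

Lemma RLJZ T t c f : t <= T -> {within `[0, T], continuous f} ->
  RLJ (fun s => c * f s) t = c * RLJ f t.
Proof.
move=> tT cf; rewrite /RLJ [RHS]mulrCA; congr (_ * _).
rewrite -(RintegralZl c _ (integrable_Lkernel_continuous tT cf))//.
by apply: eq_Rintegral => s _; rewrite mulrCA.
Qed.

Lemma RLJ_lt0 f t : t < 0 -> RLJ f t = 0.
Proof.
by move=> t0; rewrite /RLJ set_itv_ge ?bnd_simp -?ltNge// Rintegral_set0 mulr0.
Qed.

Lemma RLJ0 f : RLJ f 0 = 0.
Proof. by rewrite /RLJ set_itv1 Rintegral_set1 mulr0. Qed.

(** Projection onto [[0, T]]. Composing with it extends a function continuous on the segment to the
    whole line, as continuity under the integral sign is stated on an open interval of
    parameters. *)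
Definition clamp T s : R := Num.max 0 (Num.min s T).

Lemma clamp_id T s : s \in `[0, T] -> clamp T s = s.
Proof.
by rewrite in_itv/= => /andP[s0 sT]; rewrite /clamp (min_idPl sT) (max_idPr s0).
Qed.

Lemma clamp_in T s : 0 <= T -> clamp T s \in `[0, T].
Proof. by move=> T0; rewrite in_itv/= /clamp le_max lexx/= ge_max T0 ge_min lexx orbT. Qed.

Lemma continuous_clamp T : continuous (clamp T).
Proof.
move=> s; apply: (@continuous_max _ _ (cst 0) (fun s => Num.min s T)).
  exact: cvg_cst.
by apply: (@continuous_min _ _ id (cst T)); [exact: cvg_id|exact: cvg_cst].
Qed.

Lemma continuous_comp_clamp T y : 0 <= T -> {within `[0, T], continuous y} ->
  continuous (y \o clamp T).
Proof.
move=> T0 /subspace_continuousP cy s.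
apply: (@cvg_comp _ _ _ (clamp T) y _ (within `[0, T] (nbhs (clamp T s)))); last first.
  exact/cy/clamp_in.
move=> U /= HU.
have : nbhs s (clamp T @^-1` [set t | `[0, T]%classic t -> U t]).
  exact: (@continuous_clamp T s _ HU).
by apply: filterS => x /=; apply; exact: clamp_in.
Qed.

(** The exponents [a - 1] and [1 - a] cancel under [s = t * u], so neither kernel nor domain depends
    on [t] any more; [t] remains as a factor and inside the argument of [y]. Continuity in [t] then
    follows by domination with a multiple of [Lkernel a 1]. *)
Lemma RLJ_scale T t y : 0 <= t <= T -> {within `[0, T], continuous y} ->
  RLJ y t = (Gamma a * Gamma (2 - a))^-1 *
    (t * \int[mu]_(u in `[0, 1]) (Lkernel a 1 u * y (clamp T (t * u)))).
Proof.
move=> /andP[t0 tT] cy; have [t00|tn0] := eqVneq t 0.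
  by rewrite t00 mul0r mulr0 RLJ0.
have {tn0}t0 : 0 < t by rewrite lt_neqAle eq_sym tn0.
rewrite /RLJ; congr (_ * _); rewrite /Rintegral.
have tu u : u \in `[0, 1] -> t * u \in `[0, T].
  rewrite !in_itv/= => /andP[u0 u1]; rewrite mulr_ge0 ?(ltW t0)//=.
  by apply: le_trans tT; rewrite ler_piMr// ltW.
rewrite (@integral_scale_itv R t (fun s => Lkernel a t s * y s)
  (fun u => Lkernel a 1 u * y (clamp T (t * u))))//.
- have i1 : mu.-integrable `[0, 1] (fun u => (Lkernel a 1 u * y (clamp T (t * u)))%:E).
    apply: (@integrable_Lkernel_continuous _ 1) => //.
    apply: continuous_subspaceT => u.
    apply: (@continuous_comp _ _ _ ( *%R t) (y \o clamp T)); first exact: mulrl_continuous.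
    exact/continuous_comp_clamp/cy/(le_trans (ltW t0)).
  by rewrite fineM//; apply: integrable_fin_num.
- apply: measurable_funM; first exact: measurable_Lkernel.
  exact: within_continuous_measurable (within_continuous_sub tT cy).
- move=> u u01; rewrite clamp_id ?tu//; congr (_ * _).
  move: u01; rewrite in_itv/= => /andP[u0 u1].
  have -> : Lkernel a t (t * u) = (t * (1 - u)) `^ (a - 1) * (t * u) `^ (1 - a).
    by rewrite /Lkernel mulrBr mulr1.
  rewrite /Lkernel !powRM ?subr_ge0 ?(ltW t0)// mulrACA.
  rewrite -powRD; last by rewrite (gt_eqF t0) implybT.
  by rewrite (_ : a - 1 + (1 - a) = 0) ?powRr0 ?mul1r//; ring.
Qed.

Lemma continuous_RLJ T y : 0 <= T -> {within `[0, T], continuous y} ->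
  {within `[0, T], continuous (RLJ y)}.
Proof.
move=> T0 cy.
pose H t := \int[mu]_(u in `[0, 1]) (Lkernel a 1 u * y (clamp T (t * u))).
have cyc := continuous_comp_clamp T0 cy.
have [M M0 yM] := within_continuous_bounded cy.
have cH t : {for t, continuous H}.
  have ct u : continuous (fun l : R => Lkernel a 1 u * (y \o clamp T) (l * u)).
    move=> l; apply: cvgM; first exact: cvg_cst.
    apply: (@continuous_comp _ _ _ (fun l : R => l * u) (y \o clamp T)).
      exact: mulrr_continuous.
    exact: cyc.
  apply: (@continuity_under_integral R _ _ mu
    (fun l u => Lkernel a 1 u * y (clamp T (l * u))) `[0, 1]%classic _ (t - 1) (t + 1) _ _
    (fun u => M * Lkernel a 1 u)) => //.
  - move=> l _; apply: (@integrable_Lkernel_continuous _ 1) => //.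
    apply: continuous_subspaceT => u.
    apply: (@continuous_comp _ _ _ ( *%R l) (y \o clamp T)); first exact: mulrl_continuous.
    exact: cyc.
  - by apply: aeW => u _ l _; exact: ct.
  - rewrite (_ : EFin \o _ = (fun u => M%:E * (EFin \o Lkernel a 1) u)%E).
      by apply: integrableZl => //; exact: integrable_Lkernel.
    by apply/funext => u /=; rewrite EFinM.
  - move=> l _; apply: aeW => u _; rewrite normrM ger0_norm ?Lkernel_ge0// mulrC.
    by rewrite ler_wpM2r ?Lkernel_ge0// yM ?clamp_in.
  - by rewrite inE/= in_itv/= ltrBlDr ltrDl ltr01.
have HE : {in `[0, T]%classic,
    (fun t => (Gamma a * Gamma (2 - a))^-1 * (t * H t)) =1 RLJ y}.
  by move=> t /[1!inE]/=; rewrite in_itv/= => tT; rewrite (RLJ_scale tT cy).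
apply: (subspace_eq_continuous HE).
apply: continuous_subspaceT => t; apply: cvgM; first exact: cvg_cst.
by apply: cvgM; [exact: cvg_id|exact: cH].
Qed.

End L_kernel.

(** * Ratios and decay of the Mittag-Leffler-type coefficients *)

Section Mittag_Leffler_coefficients.
Context {R : realType}.
Local Notation mu := (@lebesgue_measure R).
Variable a : R.
Hypothesis a01 : 0 < a < 1.

Lemma ml_coef0 : ml_coef a 0 = 1.
Proof. by rewrite /ml_coef expr0 mul1r big_geq// invr1. Qed.

Lemma ml_coefS n : ml_coef a n.+1 = ml_coef a n * L_beta a n.
Proof.
rewrite /ml_coef big_nat_recr//= exprSr /L_beta.
rewrite (_ : n%:R + 2 - a = n.+2%:R - a); last by rewrite -[in RHS](addn2 n) natrD.
rewrite mulrACA invfM; congr (_ * _).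
by rewrite invfM invf_div mulrC -mulrA -invfM.
Qed.

Lemma ml_coef_gt0 n : 0 < ml_coef a n.
Proof.
elim: n => [|n IHn]; first by rewrite ml_coef0.
by rewrite ml_coefS mulr_gt0// L_beta_gt0.
Qed.

(** Up to the factor [Gamma a * Gamma (2 - a)], [L_beta a n] is the integral of
    [Lkernel a 1 u * u ^+ n] over [[0, 1]]. Since [u ^+ n] tends to 0 for [u < 1], dominated
    convergence applies with the kernel itself as bound. *)
Lemma cvg_L_beta : L_beta a n @[n --> \oo] --> 0.
Proof.
have := a01 => /andP[a0 a1].
have c0 : Gamma a * Gamma (2 - a) != 0.
  by rewrite gt_eqF// mulr_gt0// Gamma_gt0//; lra.
have bE n : (\int[mu]_(u in `[0%R, 1%R]) (Lkernel a 1 u * u ^+ n)%:E =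
    (Gamma a * Gamma (2 - a) * L_beta a n)%:E)%E.
  rewrite integral_LkernelXn// expr1n mul1r; congr EFin; rewrite /L_beta.
  have G2 : Gamma (2 - a) != 0 by move: c0; rewrite mulf_eq0 negb_or => /andP[].
  by rewrite invfM; move: (Gamma _) (Gamma _) (Gamma _)^-1 G2 {c0} => A B C D;
     move: (Gamma _) D => E E0; field.
suff : (fun n => \int[mu]_(u in `[0%R, 1%R]) (Lkernel a 1 u * u ^+ n)%:E)%E
    @ \oo --> (\int[mu]_(u in `[0%R, 1%R]) cst 0 u)%E.
  under eq_fun do rewrite bE.
  rewrite integral0 => /fine_cvg /=.
  move=> /(@cvgMr _ _ _ _ _ ((Gamma a * Gamma (2 - a))^-1)); rewrite mulr0.
  by apply: cvg_trans; apply: near_eq_cvg; near=> n; rewrite /= mulKf.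
apply: (@dominated_cvg _ _ _ mu _ _ _ _ (EFin \o Lkernel a 1)) => //.
- move=> n; apply/measurable_EFinP; apply: measurable_funM.
    exact: measurable_Lkernel.
  exact: measurable_funTS.
- move=> u; rewrite /= in_itv/= => /andP[u0 u1].
  apply: cvg_EFin; first exact: nearW.
  (* At [u = 1] the powers do not decay, but there the kernel is 0: the power of 0 with nonzero
     exponent [a - 1] is 0 by convention. *)
  have [->|un1] := eqVneq u 1.
    rewrite (_ : (fun _ => _) = cst 0); first exact: cvg_cst.
    apply/funext => n /=; rewrite /Lkernel subrr powR0 ?mul0r//.
    by rewrite subr_eq0 lt_eqF.
  apply: (@cvg_geometric _ (Lkernel a 1 u) u).
  by rewrite ger0_norm// lt_neqAle un1.
- exact: integrable_Lkernel.
- move=> n u; rewrite /= in_itv/= => /andP[u0 u1]; rewrite lee_fin.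
  rewrite normrM !ger0_norm ?Lkernel_ge0 ?exprn_ge0// ler_piMr ?Lkernel_ge0//.
  exact: exprn_ile1.
Unshelve. all: by end_near. Qed.

Lemma is_cvg_series_ratio (u r : R^nat) : (forall n, 0 <= u n) ->
  (forall n, u n.+1 = u n * r n) -> r n @[n --> \oo] --> 0 -> cvgn (series u).
Proof.
move=> u0 ur /cvgrPdist_le /(_ (2^-1)) []; first by rewrite invr_gt0.
(* From [N] on the ratios are at most 1/2, so [u n * 2 ^+ n] no longer grows. [C], a sum of
   nonnegative terms, bounds these products up to index [N], hence all of them, and a geometric
   series dominates [u]. *)
move=> N _ Nr; pose C := \sum_(i < N.+1) u i * 2 ^+ i.
have uC n : u n * 2 ^+ n <= C.
  have small m : (m <= N)%N -> u m * 2 ^+ m <= C.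
    move=> mN; have mN' : (m < N.+1)%N by [].
    rewrite /C (bigD1 (Ordinal mN'))//= lerDl sumr_ge0// => i _.
    by rewrite mulr_ge0.
  elim: n => [|n IHn]; first exact: small.
  have [/small//|Nn] := leqP n.+1 N.
  apply: le_trans IHn; have := Nr n Nn; rewrite /= sub0r normrN => rn.
  have -> : u n.+1 * 2 ^+ n.+1 = (u n * 2 ^+ n) * (r n * 2) by rewrite ur exprS; ring.
  rewrite ler_piMr ?mulr_ge0// -ler_pdivlMr// div1r.
  by rewrite (le_trans _ rn)// ler_norm.
apply: (@series_le_cvg _ _ (geometric C 2^-1)) => //.
- by move=> n; rewrite mulr_ge0 ?(le_trans _ (uC 0))// ?mulr_ge0// exprn_ge0// invr_ge0.
- by move=> n; rewrite /= exprVn ler_pdivlMr ?uC// exprn_gt0.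
by apply: is_cvg_geometric_series; rewrite ger0_norm ?invr_ge0// invf_lt1// ltr1n.
Qed.

Lemma is_cvg_series_ml_coef (K : R) : 0 <= K ->
  cvgn (series (fun n => ml_coef a n * K ^+ n)).
Proof.
move=> K0; apply: (@is_cvg_series_ratio _ (fun n => L_beta a n * K)).
- by move=> n; rewrite mulr_ge0 ?exprn_ge0// ltW// ml_coef_gt0.
- by move=> n; rewrite ml_coefS exprSr mulrACA.
- by rewrite -(mul0r K); apply: cvgMl; exact: cvg_L_beta.
Qed.

End Mittag_Leffler_coefficients.

(** * Series dominated by a numerical series *)

Section dominated_series.
Context {R : realType}.
Implicit Types (u M : R^nat).

Lemma is_cvg_series_le_norm u M : (forall n, `|u n| <= M n) ->
  cvgn (series M) -> cvgn (series u).
Proof.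
move=> uM cM; apply: normed_cvg; apply: series_le_cvg cM => // n.
- exact: normr_ge0.
- exact: le_trans (normr_ge0 _) (uM n).
Qed.

Lemma limn_series_tail u M N : (forall n, `|u n| <= M n) -> cvgn (series M) ->
  `|limn (series u) - series u N| <= limn (series M) - series M N.
Proof.
move=> uM cM; have cu := is_cvg_series_le_norm uM cM.
have h1 : (series u n - series u N) @[n --> \oo] --> limn (series u) - series u N.
  by apply: cvgB => //; exact: cvg_cst.
have h2 : (series M n - series M N) @[n --> \oo] --> limn (series M) - series M N.
  by apply: cvgB => //; exact: cvg_cst.
apply: (ler_cvg_to (cvg_norm h1) h2); near=> n.
have Nn : (N <= n)%N by near: n; exact: nbhs_infty_ge.
rewrite !sub_series_geq//; apply: (le_trans (ler_norm_sum _ _ _)).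
by apply: ler_sum => i _.
Unshelve. all: by end_near. Qed.

(** Weierstrass M-test. Tails at [t] and at [s] are bounded by the same tail of [M], and a partial
    sum is continuous: three errors of size [e / 3]. *)
Lemma within_continuous_limn_series (A : set R) (f : nat -> R -> R) M :
  (forall n, {within A, continuous (f n)}) ->
  (forall n t, A t -> `|f n t| <= M n) -> cvgn (series M) ->
  {within A, continuous (fun t => limn (series (f ^~ t)))}.
Proof.
move=> cf fM cM; apply/subspace_continuousP => t At.
apply/cvgrPdist_le => /= e e0.
have [N HN] : exists N, limn (series M) - series M N <= e / 3.
  have /cvgrPdist_le/(_ (e / 3)) := cM; case; first by rewrite divr_gt0.
  move=> N _ /(_ N (leqnn N)) /= h; exists N.
  by rewrite (le_trans _ h)// ler_norm.
have cS : (fun s => series (f ^~ s) N) @ within A (nbhs t) --> series (f ^~ t) N.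
  rewrite /series/=; elim: N {HN} => [|N IHN].
    under eq_fun do rewrite big_geq//; rewrite big_geq//; exact: cvg_cst.
  under eq_fun do rewrite big_nat_recr//=; rewrite big_nat_recr//=.
  apply: cvgD => //; have := cf N.
  by move=> /subspace_continuousP /(_ _ At).
have e3 : 0 < e / 3 by rewrite divr_gt0.
move/cvgrPdist_le : cS => /(_ _ e3) cS.
have Anear : \forall s \near within A (nbhs t), A s by exact: withinT.
near=> s.
have As : A s by near: s.
have h1 := le_trans (limn_series_tail N (fun n => fM n t At) cM) HN.
have h2 := le_trans (limn_series_tail N (fun n => fM n s As) cM) HN.
have h3 : `|series (f^~ t) N - series (f^~ s) N| <= e / 3 by near: s.
rewrite distrC in h2.
rewrite /from_subspace (_ : _ - _ = (limn (series (f ^~ t)) - series (f ^~ t) N) +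
  (series (f ^~ t) N - series (f ^~ s) N) +
  (series (f ^~ s) N - limn (series (f ^~ s)))); last first.
  by rewrite !addrA subrK subrK.
rewrite (le_trans (ler_normD _ _))// (_ : e = e / 3 + e / 3 + e / 3); last by field.
by rewrite lerD// (le_trans (ler_normD _ _))// lerD.
Unshelve. all: by end_near. Qed.

End dominated_series.

(** * Complex vectors and matrices *)

Section complex_parts.
Context {R : realType}.
Implicit Types (z w : R[i]) (b : bool).

(** The boolean selector allows each statement on real and imaginary parts to be proved once for
    both. *)
Definition part b z : R := if b then complex.Re z else complex.Im z.

Lemma partP z w : (forall b, part b z = part b w) -> z = w.
Proof.
by case: z w => [x y] [x' y'] h; rewrite (h true : x = x') (h false : y = y').
Qed.

Lemma partD b z w : part b (z + w) = part b z + part b w.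
Proof. by case: b z w => -[? ?] [? ?]. Qed.

Lemma part0 b : part b 0 = 0. Proof. by case: b. Qed.

Lemma partZ b (r : R) z : part b (r%:C * z) = r * part b z.
Proof. by case: b z => -[x y] /=; rewrite ?mul0r ?subr0 ?addr0. Qed.

Lemma part_sum b (I : Type) (r : seq I) (P : pred I) (F : I -> R[i]) :
  part b (\sum_(i <- r | P i) F i) = \sum_(i <- r | P i) part b (F i).
Proof. by apply: (big_morph (part b) (partD b) (part0 b)). Qed.

(* Multiplication by z is the real 2x2 matrix ((Re z, -Im z), (Im z, Re z)). *)
Definition mul_coef b c z : R :=
  if b then (if c then complex.Re z else - complex.Im z)
  else (if c then complex.Im z else complex.Re z).

Lemma partM b z w : part b (z * w) =
  mul_coef b true z * part true w + mul_coef b false z * part false w.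
Proof. by case: b z w => -[x y] [x' y']; rewrite /= ?mulNr 1?addrC// mulrC addrC. Qed.

(* Used instead of the modulus: submultiplicative, with no square root. *)
Definition norm1 z : R := `|complex.Re z| + `|complex.Im z|.

Lemma norm1_ge0 z : 0 <= norm1 z. Proof. by rewrite addr_ge0. Qed.

Lemma part_le_norm1 b z : `|part b z| <= norm1 z.
Proof. by case: b; rewrite /norm1 /part ?lerDl ?lerDr. Qed.

Lemma norm1_le z M : (forall b, `|part b z| <= M) -> norm1 z <= M + M.
Proof. by move=> h; rewrite lerD ?(h true) ?(h false). Qed.

Lemma norm1D z w : norm1 (z + w) <= norm1 z + norm1 w.
Proof. by case: z w => [x y] [x' y']; rewrite /norm1/= addrACA lerD// ler_normD. Qed.

Lemma norm1_0 : norm1 0 = 0.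
Proof. by rewrite /norm1/= normr0 addr0. Qed.

Lemma norm1M z w : norm1 (z * w) <= norm1 z * norm1 w.
Proof.
case: z w => [x y] [x' y']; rewrite /norm1/=.
have h1 := ler_normB (x * x') (y * y'); have h2 := ler_normD (x * y') (y * x').
apply: (le_trans (lerD h1 h2)); rewrite !normrM.
rewrite le_eqVlt; apply/orP; left; apply/eqP; ring.
Qed.

Lemma norm1Z (r : R) z : norm1 (r%:C * z) = `|r| * norm1 z.
Proof. by case: z => x y; rewrite /norm1/= !mul0r subr0 addr0 !normrM mulrDr. Qed.

Variable d : nat.
Implicit Types (v : 'cV[R[i]]_d) (A : 'M[R[i]]_d).

Definition normv v : R := \sum_i norm1 (v i 0).
Definition normm A : R := \sum_i \sum_j norm1 (A i j).

Lemma normv_ge0 v : 0 <= normv v. Proof. by apply: sumr_ge0 => i _; exact: norm1_ge0. Qed.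
Lemma normm_ge0 A : 0 <= normm A.
Proof. by do 2!apply: sumr_ge0 => ? _; exact: norm1_ge0. Qed.

Lemma part_le_normv b v i : `|part b (v i 0)| <= normv v.
Proof.
apply: (le_trans (part_le_norm1 b _)); rewrite /normv (bigD1 i)//= lerDl.
by apply: sumr_ge0 => j _; exact: norm1_ge0.
Qed.

Lemma normv_le v M : (forall b i, `|part b (v i 0)| <= M) -> normv v <= M *+ (2 * d).
Proof.
move=> h; rewrite -[d in X in _ <= X]card_ord mulrnA -sumr_const; apply: ler_sum => i _.
by rewrite mulr2n norm1_le.
Qed.

Lemma normvD v (w : 'cV[R[i]]_d) : normv (v + w) <= normv v + normv w.
Proof. by rewrite -big_split; apply: ler_sum => i _; rewrite mxE norm1D. Qed.

Lemma normv0 : normv 0 = 0.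
Proof. by apply: big1 => i _; rewrite mxE norm1_0. Qed.

Lemma normvZ (r : R) v : normv (r%:C *: v) = `|r| * normv v.
Proof. by rewrite mulr_sumr; apply: eq_bigr => i _; rewrite mxE norm1Z. Qed.

Lemma normv_sum (N : nat) (F : nat -> 'cV[R[i]]_d) :
  normv (\sum_(n < N) F n) <= \sum_(n < N) normv (F n).
Proof.
elim: N => [|N IHN]; first by rewrite !big_ord0 normv0.
by rewrite !big_ord_recr/= (le_trans (normvD _ _))// lerD.
Qed.

Lemma normv_mul A v : normv (A *m v) <= normm A * normv v.
Proof.
rewrite mulr_suml; apply: ler_sum => i _; rewrite mxE mulr_suml.
rewrite (le_trans (_ : _ <= \sum_j norm1 (A i j * v j 0)))//.
  elim/big_ind2: _ => [|z x w y zx wy|//]; first by rewrite norm1_0.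
  by rewrite (le_trans (norm1D _ _))// lerD.
apply: ler_sum => j _; rewrite (le_trans (norm1M _ _))//.
rewrite ler_wpM2l ?norm1_ge0// /normv (bigD1 j)//= lerDl.
by apply: sumr_ge0 => k _; exact: norm1_ge0.
Qed.

Lemma normv_expmul A n v : normv (A ^+ n *m v) <= normm A ^+ n * normv v.
Proof.
elim: n => [|n IHn]; first by rewrite !expr0 mul1mx mul1r.
rewrite exprS -[A * _]/(A *m _) -mulmxA (le_trans (normv_mul _ _))//.
by rewrite exprS -mulrA ler_wpM2l ?normm_ge0.
Qed.

(** The entry is a component of [A ^+ n] applied to a basis vector, which has norm 1. *)
Lemma part_expmx_le b A n i j : `|part b ((A ^+ n) i j)| <= normm A ^+ n.
Proof.
have := normv_expmul A n (delta_mx j 0).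
have -> : normv (delta_mx j 0) = 1.
  rewrite /normv (bigD1 j)//= big1 => [|k /negbTE kj]; last by rewrite mxE kj norm1_0.
  by rewrite mxE !eqxx addr0 /norm1/= normr0 normr1 addr0.
rewrite mulr1; apply: le_trans; apply: le_trans (part_le_normv b _ i).
by rewrite -colE mxE.
Qed.

Lemma expmxZ (c : R[i]) A n : (c *: A) ^+ n = c ^+ n *: A ^+ n.
Proof.
elim: n => [|n IHn]; first by rewrite !expr0 scale1r.
rewrite !exprS IHn -[(c *: A) * _]/((c *: A) *m _) -scalemxAl -scalemxAr.
by rewrite scalerA.
Qed.

End complex_parts.

Section complex_limits.
Context {R : realType}.
Implicit Types m n : nat.

(** Relational counterpart of [ccvg] and [clim], which combines directly with sums and matrix
    products. *)
Definition ctends m n (u : nat -> 'M[R[i]]_(m, n)) (L : 'M[R[i]]_(m, n)) : Prop :=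
  forall b i j, part b (u k i j) @[k --> \oo] --> part b (L i j).

Lemma ccvg_ctends m n (u : nat -> 'M[R[i]]_(m, n)) : ccvg u -> ctends u (clim u).
Proof. by move=> cu [] i j; rewrite mxE; have [] := cu i j. Qed.

Lemma ctendsD m n (u v : nat -> 'M[R[i]]_(m, n)) L M : ctends u L -> ctends v M ->
  ctends (fun k => u k + v k) (L + M).
Proof.
move=> uL vM b i j; rewrite mxE partD; under eq_fun do rewrite mxE partD.
by apply: cvgD; [exact: uL|exact: vM].
Qed.

Lemma cvg_sumr (I : finType) (u : I -> R^nat) (l : I -> R) :
  (forall i, u i k @[k --> \oo] --> l i) ->
  \sum_i u i k @[k --> \oo] --> \sum_i l i.
Proof.
move=> ul; rewrite (_ : (fun k => _) = \sum_i u i); last first.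
  by apply/funext => k; rewrite fct_sumE.
elim/big_ind2: _ => [|x f y g xf yg|i _]; [exact: cvg_cst|exact: cvgD|exact: ul].
Qed.

Lemma cvg_partM b (u v : nat -> R[i]) z w :
  (forall c, part c (u k) @[k --> \oo] --> part c z) ->
  (forall c, part c (v k) @[k --> \oo] --> part c w) ->
  part b (u k * v k) @[k --> \oo] --> part b (z * w).
Proof.
move=> uz vw; rewrite partM; under eq_fun do rewrite partM.
apply: cvgD; apply: cvgM => //; case: b.
- exact: (uz true).
- exact: (uz false).
- by apply: cvgN; exact: (uz false).
- exact: (uz true).
Qed.

Lemma ctendsM m n p (u : nat -> 'M[R[i]]_(m, n)) (v : nat -> 'M[R[i]]_(n, p)) L M :
  ctends u L -> ctends v M -> ctends (fun k => u k *m v k) (L *m M).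
Proof.
move=> uL vM b i j; rewrite mxE part_sum; under eq_fun do rewrite mxE part_sum.
by apply: cvg_sumr => k; apply: cvg_partM => c; [exact: uL|exact: vM].
Qed.

Lemma ctends_cst m n (L : 'M[R[i]]_(m, n)) : ctends (fun=> L) L.
Proof. by move=> b i j; exact: cvg_cst. Qed.

End complex_limits.

(** * The L-fractional integral of vector-valued functions *)

Section LJ_vector.
Context {R : realType}.
Local Notation mu := (@lebesgue_measure R).
Variables (a : R) (d : nat).
Hypothesis a01 : 0 < a < 1.
Implicit Types (T t s : R) (y z : R -> 'cV[R[i]]_d) (A : 'M[R[i]]_d).

Lemma ccont_onP T y : ccont_on T y <->
  forall b i, {within `[0, T], continuous (fun s => part b (y s i 0))}.
Proof.
split=> [cy [] i|cy i]; [by have [] := cy i|by have [] := cy i|].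
by split; [exact: (cy true)|exact: (cy false)].
Qed.

Lemma cintegrableP (D : set R) y : cintegrable D y <->
  forall b i, mu.-integrable D (fun s => (part b (y s i 0))%:E).
Proof.
split=> [cy [] i|cy i]; [by have [] := cy i|by have [] := cy i|].
by split; [exact: (cy true)|exact: (cy false)].
Qed.

Lemma part_cint b (D : set R) y i :
  part b (cint D y i 0) = \int[mu]_(s in D) part b (y s i 0).
Proof. by rewrite mxE; case: b. Qed.

Lemma part_LJ b y t i :
  part b (LJ a y t i 0) = RLJ a (fun s => part b (y s i 0)) t.
Proof.
rewrite mxE partZ part_cint; congr (_ * _); apply: eq_Rintegral => s _.
by rewrite mxE partZ.
Qed.

Lemma ccont_onD T y z : ccont_on T y -> ccont_on T z ->
  ccont_on T (fun s => y s + z s).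
Proof.
move=> /ccont_onP cy /ccont_onP cz; apply/ccont_onP => b i.
rewrite (_ : (fun s => _) = (fun s => part b (y s i 0) + part b (z s i 0))); last first.
  by apply/funext => s; rewrite mxE partD.
by move=> s; apply: cvgD; [exact: cy|exact: cz].
Qed.

Lemma within_continuous_sumr T (I : finType) (f : I -> R -> R) :
  (forall j, {within `[0, T], continuous (f j)}) ->
  {within `[0, T], continuous (fun s => \sum_j f j s)}.
Proof.
move=> cf; rewrite (_ : (fun s => _) = \sum_j f j); last first.
  by apply/funext => s; rewrite fct_sumE.
elim/big_ind: _ => [|x y cx cy|i _]; last exact: cf.
  by apply: continuous_subspaceT => s; exact: cvg_cst.
by move=> s; apply: cvgD; [exact: cx|exact: cy].
Qed.

(** One summand of a part of [A *m v], written as a real linear combination. In this form the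
    L-integral commutes with a complex matrix by real linearity alone. *)
Definition rowpart b A i (j : 'I_d) (v : 'cV[R[i]]_d) : R :=
  mul_coef b true (A i j) * part true (v j 0) + mul_coef b false (A i j) * part false (v j 0).

Lemma part_mulmx b A v i : part b ((A *m v) i 0) = \sum_j rowpart b A i j v.
Proof. by rewrite mxE part_sum; apply: eq_bigr => j _; rewrite partM. Qed.

Lemma within_continuousZ T (c : R) (f : R -> R) : {within `[0, T], continuous f} ->
  {within `[0, T], continuous (fun s => c * f s)}.
Proof. by move=> cf s; apply: cvgM; [exact: cvg_cst|exact: cf]. Qed.

Lemma within_continuousD T (f g : R -> R) : {within `[0, T], continuous f} ->
  {within `[0, T], continuous g} ->
  {within `[0, T], continuous (fun s => f s + g s)}.
Proof. by move=> cf cg s; apply: cvgD; [exact: cf|exact: cg]. Qed.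

Lemma within_continuous_rowpart T y b A i j : ccont_on T y ->
  {within `[0, T], continuous (fun s => rowpart b A i j (y s))}.
Proof.
move=> /ccont_onP cy.
by apply: within_continuousD; apply: within_continuousZ; exact: cy.
Qed.

Lemma ccont_onM T A y : ccont_on T y -> ccont_on T (fun s => A *m y s).
Proof.
move=> cy; apply/ccont_onP => b i.
rewrite (_ : (fun s => _) = (fun s => \sum_j rowpart b A i j (y s))); last first.
  by apply/funext => s; rewrite part_mulmx.
by apply: within_continuous_sumr => j; exact: within_continuous_rowpart.
Qed.

Lemma ccont_on_LJ T y : 0 <= T -> ccont_on T y -> ccont_on T (LJ a y).
Proof.
move=> T0 /ccont_onP cy; apply/ccont_onP => b i.
rewrite (_ : (fun s => _) = RLJ a (fun s => part b (y s i 0))); last first.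
  by apply/funext => s; rewrite part_LJ.
exact: continuous_RLJ.
Qed.

Lemma ccont_on_LJn T y n : 0 <= T -> ccont_on T y -> ccont_on T (LJn n a y).
Proof. by move=> T0 cy; elim: n => //= n IHn; exact: ccont_on_LJ. Qed.

Lemma ccont_on_cst T (v : 'cV[R[i]]_d) : ccont_on T (fun=> v).
Proof. by apply/ccont_onP => b i; apply: continuous_subspaceT => s; exact: cvg_cst. Qed.

Lemma LJD T t y z : t <= T -> ccont_on T y -> ccont_on T z ->
  LJ a (fun s => y s + z s) t = LJ a y t + LJ a z t.
Proof.
move=> tT /ccont_onP cy /ccont_onP cz; apply/matrixP => i j; rewrite ord1 [RHS]mxE.
apply: partP => b; rewrite partD !part_LJ -(RLJD a01 tT)//.
by apply: eq_RLJ => s _; rewrite mxE partD.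
Qed.

Lemma RLJ_sum T t (I : finType) (f : I -> R -> R) : t <= T ->
  (forall j, {within `[0, T], continuous (f j)}) ->
  RLJ a (fun s => \sum_j f j s) t = \sum_j RLJ a (f j) t.
Proof.
(* Additivity of [RLJ] requires continuity of both summands, so the induction carries continuity
   along with the value. *)
move=> tT cf; pose P (g : R -> R) (r : R) := RLJ a g t = r /\ {within `[0, T], continuous g}.
suff [] : P (fun s => \sum_j f j s) (\sum_j RLJ a (f j) t) by [].
rewrite (_ : (fun s => _) = \sum_j f j); last first.
  by apply/funext => s; rewrite fct_sumE.
elim/big_ind2: _ => [|g r h q [gr cg] [hq ch]|i _]; last by split.
  split; last by apply: continuous_subspaceT => s; exact: cvg_cst.
  have -> : (0 : R -> R) = (fun s => 0 * (fun=> 0) s) by apply/funext => s; rewrite mul0r.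
  rewrite (RLJZ a01 _ tT) ?mul0r//.
  by apply: continuous_subspaceT => s; exact: cvg_cst.
split; last exact: within_continuousD.
by rewrite -gr -hq -(RLJD a01 tT).
Qed.

Lemma LJM T t A y : t <= T -> ccont_on T y ->
  LJ a (fun s => A *m y s) t = A *m LJ a y t.
Proof.
move=> tT cy; apply/matrixP => i j; rewrite ord1; apply: partP => b.
rewrite part_LJ part_mulmx.
rewrite -(@eq_RLJ _ _ _ (fun s => \sum_j rowpart b A i j (y s))); last first.
  by move=> s _; rewrite part_mulmx.
rewrite (RLJ_sum tT); last by move=> k; exact: within_continuous_rowpart.
move/ccont_onP : cy => cy.
apply: eq_bigr => k _; rewrite (RLJD a01 tT); try exact: within_continuousZ.
by rewrite !(RLJZ a01 _ tT)// /rowpart !part_LJ.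
Qed.

Lemma eq_LJ t y z : {in `[0, t], y =1 z} -> LJ a y t = LJ a z t.
Proof.
move=> yz; apply/matrixP => i j; rewrite ord1; apply: partP => b.
by rewrite !part_LJ; apply: eq_RLJ => s st; rewrite yz.
Qed.

Lemma LJ_Xn n (v : 'cV[R[i]]_d) t : 0 <= t ->
  LJ a (fun s => (s ^+ n)%:C *: v) t = (L_beta a n * t ^+ n.+1)%:C *: v.
Proof.
move=> t0; apply/matrixP => i j; rewrite ord1; apply: partP => b.
rewrite part_LJ mxE partZ -RLJXn// mulrC.
rewrite -(RLJZ a01 _ (lexx t)); last exact: (continuous_subspaceT (@exprn_continuous R n)).
by apply: eq_RLJ => s _; rewrite mxE partZ mulrC.
Qed.

Lemma RLJ_dominated_cvg t T (f : nat -> R -> R) (g : R -> R) C : t <= T ->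
  (forall n, {within `[0, T], continuous (f n)}) ->
  {within `[0, T], continuous g} ->
  (forall n, {in `[0, T], forall s, `|f n s| <= C}) ->
  {in `[0, T], forall s, f n s @[n --> \oo] --> g s} ->
  RLJ a (f n) t @[n --> \oo] --> RLJ a g t.
Proof.
move=> tT cf cg fC fg; apply: cvgMr; apply: fine_cvg.
have sT s : s \in `[0, t] -> s \in `[0, T].
  by rewrite !in_itv/= => /andP[-> st]; exact: le_trans tT.
have fgt s : `[0, t]%classic s -> (Lkernel a t s * f n s)%:E @[n --> \oo] --> (Lkernel a t s * g s)%:E.
  move=> /= st; apply: cvg_EFin; first exact: nearW.
  by apply: cvgMr; apply: fg; exact: sT.
have mf n : measurable_fun `[0, t] (fun s => (Lkernel a t s * f n s)%:E).
  apply/measurable_EFinP; apply: measurable_funM; first exact: measurable_Lkernel.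
  exact: within_continuous_measurable (within_continuous_sub tT (cf n)).
have dom n s : `[0, t]%classic s -> (`|(Lkernel a t s * f n s)%:E| <= (C * Lkernel a t s)%:E)%E.
  move=> /= st; rewrite lee_fin normrM ger0_norm ?Lkernel_ge0// mulrC.
  by rewrite ler_wpM2r ?Lkernel_ge0// fC// sT.
have iC : mu.-integrable `[0, t] (fun s => (C * Lkernel a t s)%:E).
  rewrite (_ : (fun s => _) = (fun u => C%:E * (EFin \o Lkernel a t) u)%E).
    by apply: integrableZl => //; exact: integrable_Lkernel.
  by apply/funext => u /=; rewrite EFinM.
rewrite fineK; last exact: integrable_fin_num (integrable_Lkernel_continuous a01 tT cg).
by apply: (@dominated_cvg _ _ _ mu _ (measurable_itv `[0, t]) _ _
  (fun s => (C * Lkernel a t s)%:E)).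
Qed.

End LJ_vector.

(** * Picard iteration *)

Section Picard.
Context {R : realType}.
Local Notation mu := (@lebesgue_measure R).
Variables (a T : R) (d : nat) (A : 'M[R[i]]_d) (th : R -> 'cV[R[i]]_d) (x0 : 'cV[R[i]]_d).
Hypotheses (a01 : 0 < a < 1) (T0 : 0 <= T) (cth : ccont_on T th).
Implicit Types (t s : R).

(** [L_beta a n] is the L-integral of [s ^+ n] at 1; on [[0, 1]] this power is at most 1, and the
    L-integral of 1 is 1 there. *)
Lemma L_beta_le1 n : L_beta a n <= 1.
Proof.
have := @RLJ_le0 R a a01 1 (fun s => s ^+ n) 1 ler01 ler01.
rewrite RLJXn// expr1n !mulr1 ger0_norm ?(ltW (L_beta_gt0 a01 n))//.
apply; first exact: measurable_funTS.
move=> s; rewrite in_itv/= => /andP[s0 s1].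
by rewrite ger0_norm ?exprn_ge0// exprn_ile1.
Qed.

Lemma ccont_on_normv y : ccont_on T y ->
  exists2 B, 0 <= B & {in `[0, T], forall s, normv (y s : 'cV[R[i]]_d) <= B}.
Proof.
move=> /ccont_onP cy.
have /fin_all_exists[M HM] (p : bool * 'I_d) : exists M : R,
    0 <= M /\ {in `[0, T], forall s, `|part p.1 (y s p.2 0)| <= M}.
  by have [M M0 yM] := within_continuous_bounded (cy p.1 p.2); exists M; split => //; exact: ltW.
pose C := \sum_p M p.
have C0 : 0 <= C by apply: sumr_ge0 => p _; have [] := HM p.
exists (C *+ (2 * d)); first exact: mulrn_wge0.
move=> s sT; apply: normv_le => b i; have [_ h] := HM (b, i).
rewrite (le_trans (h _ sT))// /C (bigD1 (b, i))//= lerDl.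
by apply: sumr_ge0 => p _; have [] := HM p.
Qed.

Lemma normv_LJn_le : exists2 B, 0 <= B & forall n, {in `[0, T], forall t,
  normv (LJn n a th t) <= B * (ml_coef a n * t ^+ n)}.
Proof.
have [B B0 HB] := ccont_on_normv cth.
exists (B *+ (2 * d)); first exact: mulrn_wge0.
(* The induction runs on single parts, so the factor [2 * d] for passing to the norm enters once and
   is not compounded. *)
suff H n b i : {in `[0, T], forall t,
    `|part b (LJn n a th t i 0)| <= B * (ml_coef a n * t ^+ n)}.
  by move=> n t tT; rewrite mulrnAl; apply: normv_le => b i; exact: H.
elim: n b i => [|n IHn] b i t tT.
  by rewrite ml_coef0 mul1r mulr1 (le_trans (part_le_normv _ _ _))// HB.
have -> : B * (ml_coef a n.+1 * t ^+ n.+1) = B * ml_coef a n * (L_beta a n * t ^+ n.+1).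
  by rewrite ml_coefS; ring.
rewrite part_LJ; have ct := ccont_on_LJn a01 n T0 cth.
move: tT; rewrite in_itv/= => /andP[t0 tT].
apply: (@RLJ_le _ _ a01 t _ (B * ml_coef a n) n t0).
- by rewrite mulr_ge0// ltW// ml_coef_gt0.
- apply: within_continuous_measurable; apply: (within_continuous_sub tT).
  by move/ccont_onP : ct => /(_ b i).
- move=> s; rewrite in_itv/= => /andP[s0 st]; rewrite -mulrA; apply: IHn.
  by rewrite in_itv/= s0 (le_trans st).
Qed.

Definition sol_term n t : 'cV[R[i]]_d :=
  (ml_coef a n * t ^+ n)%:C *: (A ^+ n *m x0) + A ^+ n *m LJn n.+1 a th t.

Definition sol_partial N t : 'cV[R[i]]_d := \sum_(n < N) sol_term n t.

Lemma ML_partialE t N : ML_partial a (t%:C *: A) N =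
  \sum_(n < N) (ml_coef a n * t ^+ n)%:C *: A ^+ n.
Proof.
by apply: eq_bigr => n _; rewrite expmxZ scalerA -rmorphXn/= -rmorphM.
Qed.

Lemma sol_partialE N t :
  sol_partial N t = ML_partial a (t%:C *: A) N *m x0 + LJ_partial a A th t N.
Proof.
rewrite ML_partialE mulmx_suml -big_split; apply: eq_bigr => n _.
by rewrite -scalemxAl.
Qed.

Lemma ccont_on_sol_term n : ccont_on T (sol_term n).
Proof.
apply: ccont_onD; last exact/ccont_onM/ccont_on_LJn.
apply/ccont_onP => b i.
rewrite (_ : (fun s => _) = (fun s => (ml_coef a n * part b ((A ^+ n *m x0) i 0)) * s ^+ n)).
  by apply: continuous_subspaceT => s; apply: cvgM; [exact: cvg_cst|exact: exprn_continuous].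
by apply/funext => s; rewrite mxE partZ mulrAC.
Qed.

Lemma sol_partialSr N t : sol_partial N.+1 t = sol_partial N t + sol_term N t.
Proof. by rewrite /sol_partial big_ord_recr. Qed.

Lemma ccont_on_sol_partial N : ccont_on T (sol_partial N).
Proof.
elim: N => [|N IHN].
  rewrite (_ : sol_partial 0 = fun=> 0); first exact: ccont_on_cst.
  by apply/funext => t; rewrite /sol_partial big_ord0.
rewrite (_ : sol_partial N.+1 = fun t => sol_partial N t + sol_term N t).
  by apply: ccont_onD => //; exact: ccont_on_sol_term.
by apply/funext => t; rewrite sol_partialSr.
Qed.

(** In the power part, [L_beta a n] is the ratio of consecutive coefficients; in the other part, the
    matrix powers leave the integral and one more [LJ] is applied. *)
Lemma sol_termS n t : 0 <= t <= T -> sol_term n.+1 t = LJ a (fun s => A *m sol_term n s) t.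
Proof.
move=> /andP[t0 tT]; rewrite (LJM a01 _ tT (ccont_on_sol_term n)).
pose y s : 'cV[R[i]]_d := (s ^+ n)%:C *: ((ml_coef a n)%:C *: (A ^+ n *m x0)).
have cy : ccont_on T y.
  apply/ccont_onP => b i.
  rewrite (_ : (fun s => _) = (fun s => (part b (((ml_coef a n)%:C *: (A ^+ n *m x0)) i 0)) * s ^+ n)).
    by apply: continuous_subspaceT => s; apply: cvgM; [exact: cvg_cst|exact: exprn_continuous].
  by apply/funext => s; rewrite mxE partZ mulrC.
have -> : LJ a (sol_term n) t = LJ a (fun s => y s + A ^+ n *m LJn n.+1 a th s) t.
  by apply: eq_LJ => s _; rewrite /sol_term /y scalerA -rmorphM/= mulrC.
have cLJ := ccont_on_LJn a01 n.+1 T0 cth.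
rewrite (LJD a01 tT cy (ccont_onM _ cLJ)) (LJM a01 _ tT cLJ).
rewrite LJ_Xn// mulmxDr /sol_term; congr (_ + _); last by rewrite mulmxA exprS.
rewrite scalerA -rmorphM/= -scalemxAr mulmxA -[A *m A ^+ n]/(A * A ^+ n) -exprS ml_coefS.
by congr (_%:C *: _); ring.
Qed.

Lemma sol_partialS N t : 0 <= t <= T ->
  sol_partial N.+1 t = x0 + LJ a (fun s => A *m sol_partial N s + th s) t.
Proof.
move=> tT; have [t0 tT'] := andP tT; elim: N => [|N IHN].
  (* The iteration starts from the empty sum 0, so the first iterate is [x0 + LJ a th]. *)
  rewrite /sol_partial big_ord1 /sol_term !expr0 !mul1mx ml_coef0 mulr1 scale1r.
  by congr (_ + _); apply: eq_LJ => s _; rewrite big_ord0 mulmx0 add0r.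
rewrite sol_partialSr IHN (sol_termS _ tT) -addrA.
congr (_ + _); rewrite -(LJD a01 tT'); last 2 first.
- exact/ccont_onD/cth/ccont_onM/ccont_on_sol_partial.
- exact/ccont_onM/ccont_on_sol_term.
by apply: eq_LJ => s _ /=; rewrite sol_partialSr [in RHS]mulmxDr [RHS]addrAC.
Qed.

(** The terms of the Mittag-Leffler-type series at the real number [T * normm A]; every series of
    this section is dominated by a multiple of it. *)
Definition majorant n : R := ml_coef a n * (T * normm A) ^+ n.

Lemma majorant_ge0 n : 0 <= majorant n.
Proof.
by rewrite mulr_ge0 ?(ltW (ml_coef_gt0 a01 n))// exprn_ge0// mulr_ge0// normm_ge0.
Qed.

Lemma is_cvg_series_majorant : cvgn (series majorant).
Proof. by apply: is_cvg_series_ml_coef => //; rewrite mulr_ge0// normm_ge0. Qed.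

Let in_T t : 0 <= t <= T -> t \in `[0, T]. Proof. by rewrite in_itv. Qed.

Lemma ml_coef_exp_le n t (w : R) : 0 <= t <= T -> w <= normm A ^+ n ->
  ml_coef a n * t ^+ n * w <= majorant n.
Proof.
move=> /andP[t0 tT] wA; rewrite /majorant -mulrA ler_wpM2l ?(ltW (ml_coef_gt0 a01 n))//.
rewrite exprMn (le_trans (ler_wpM2l (exprn_ge0 _ t0) wA))//.
by rewrite ler_wpM2r ?exprn_ge0 ?normm_ge0// lerXn2r.
Qed.

Lemma LJ_term_le : exists2 B, 0 <= B & forall n t, 0 <= t <= T ->
  normv (A ^+ n *m LJn n.+1 a th t) <= B * majorant n.
Proof.
have [B B0 HB] := normv_LJn_le; exists (B * T); first exact: mulr_ge0.
move=> n t tT; have [t0 tT'] := andP tT.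
rewrite (le_trans (normv_expmul _ _ _))//.
have H := HB n.+1 t (in_T tT).
rewrite (le_trans (ler_wpM2l (exprn_ge0 n (normm_ge0 A)) H))//.
(* [LJn] has one index more than the power of [A]. The surplus factor [t * L_beta a n] is at most
   [T], which explains the constant [B * T]. *)
have -> : normm A ^+ n * (B * (ml_coef a n.+1 * t ^+ n.+1)) =
  B * (t * L_beta a n) * (ml_coef a n * t ^+ n * normm A ^+ n).
  by rewrite ml_coefS exprS; ring.
have L0 := ltW (L_beta_gt0 a01 n).
apply: ler_pM.
- exact: mulr_ge0 B0 (mulr_ge0 t0 L0).
- by rewrite mulr_ge0 ?mulr_ge0 ?exprn_ge0 ?normm_ge0// ltW// ml_coef_gt0.
- by rewrite ler_wpM2l// (le_trans _ tT')// ler_piMr// L_beta_le1.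
- exact: ml_coef_exp_le.
Qed.

Lemma sol_term_le : exists2 D, 0 <= D & forall n t, 0 <= t <= T ->
  normv (sol_term n t) <= D * majorant n.
Proof.
have [B B0 HB] := LJ_term_le; exists (normv x0 + B); first by rewrite addr_ge0// normv_ge0.
move=> n t tT; have [t0 tT'] := andP tT.
rewrite (le_trans (normvD _ _))// mulrDl lerD ?HB//.
have c0 : 0 <= ml_coef a n * t ^+ n by rewrite mulr_ge0 ?exprn_ge0 ?(ltW (ml_coef_gt0 a01 n)).
rewrite normvZ ger0_norm//.
rewrite (le_trans (ler_wpM2l c0 (normv_expmul _ _ _)))// mulrA mulrC.
by rewrite ler_wpM2l ?normv_ge0// ml_coef_exp_le.
Qed.

Lemma ccvg_series m (u : nat -> 'M[R[i]]_(d, m)) (M : R^nat) :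
  (forall b n i j, `|part b (u n i j)| <= M n) -> cvgn (series M) ->
  ccvg (fun N => \sum_(n < N) u n).
Proof.
move=> uM cM i j.
have H b : cvgn (fun N => part b ((\sum_(n < N) u n) i j)).
  rewrite (_ : (fun N => _) = series (fun n => part b (u n i j))).
    by apply: is_cvg_series_le_norm cM.
  by apply/funext => N; rewrite summxE part_sum seriesEord.
by split; [exact: (H true)|exact: (H false)].
Qed.

Lemma ccvg_ML_partial t : 0 <= t <= T -> ccvg (ML_partial a (t%:C *: A)).
Proof.
move=> tT; have [t0 tT'] := andP tT; rewrite (funext (ML_partialE t)).
apply: (@ccvg_series _ (fun n => (ml_coef a n * t ^+ n)%:C *: A ^+ n) majorant _
  is_cvg_series_majorant) => b n i j.
rewrite mxE partZ normrM ger0_norm; last first.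
  by rewrite mulr_ge0 ?exprn_ge0 ?(ltW (ml_coef_gt0 a01 n)).
by rewrite ml_coef_exp_le// part_expmx_le.
Qed.

Lemma is_cvg_series_majorantZ D : cvgn (series (fun n => D * majorant n)).
Proof.
rewrite (_ : (fun n => _) = D *: majorant) //.
exact/is_cvg_seriesZ/is_cvg_series_majorant.
Qed.

Lemma ccvg_LJ_partial t : 0 <= t <= T -> ccvg (LJ_partial a A th t).
Proof.
move=> tT; have [B B0 HB] := LJ_term_le.
apply: (@ccvg_series _ (fun n => A ^+ n *m LJn n.+1 a th t) (fun n => B * majorant n)).
  by move=> b n i j; rewrite ord1 (le_trans (part_le_normv _ _ _))// HB.
exact: is_cvg_series_majorantZ.
Qed.

Local Notation x := (sol a A th x0).

Lemma ctends_sol t : 0 <= t <= T -> ctends (fun N => sol_partial N t) (x t).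
Proof.
move=> tT; rewrite (funext (sol_partialE ^~ t)).
apply: ctendsD; last exact/ccvg_ctends/ccvg_LJ_partial.
by apply: ctendsM; [exact/ccvg_ctends/ccvg_ML_partial|exact: ctends_cst].
Qed.

Lemma ccont_on_sol : ccont_on T x.
Proof.
have [D D0 HD] := sol_term_le.
apply/ccont_onP => b i.
pose f n t := part b (sol_term n t i 0).
have fx : {in `[0, T]%classic, (fun t => limn (series (f ^~ t))) =1 (fun t => part b (x t i 0))}.
  move=> t /[1!inE]/=; rewrite in_itv/= => tT; apply/cvg_lim => //.
  rewrite (_ : series _ = fun N => part b (sol_partial N t i 0)); last first.
    by apply/funext => N; rewrite summxE part_sum seriesEord.
  exact: ctends_sol.
apply: (subspace_eq_continuous fx).
apply: (@within_continuous_limn_series _ _ f (fun n => D * majorant n)).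
- by move=> n; move/ccont_onP : (ccont_on_sol_term n) => /(_ b i).
- move=> n t /=; rewrite in_itv/= => tT.
  by rewrite (le_trans (part_le_normv _ _ _))// HD.
- exact: is_cvg_series_majorantZ.
Qed.

Lemma ccont_on_rhs : ccont_on T (fun s => A *m x s + th s).
Proof. exact/ccont_onD/cth/ccont_onM/ccont_on_sol. Qed.

Lemma sol_integral_eq t : 0 <= t <= T ->
  x t = x0 + LJ a (fun s => A *m x s + th s) t.
Proof.
move=> tT; have [t0 tT'] := andP tT.
apply/matrixP => i j; rewrite ord1; apply: partP => b.
have h1 : part b (sol_partial N.+1 t i 0) @[N --> \oo] --> part b (x t i 0).
  by rewrite (cvg_shiftS (fun N => part b (sol_partial N t i 0))); exact: ctends_sol.
suff h2 : part b (sol_partial N.+1 t i 0) @[N --> \oo] -->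
    part b ((x0 + LJ a (fun s => A *m x s + th s) t) i 0).
  by apply: (cvg_unique _ h1 h2); exact: Rhausdorff.
rewrite [in X in _ --> X]mxE partD part_LJ.
under eq_fun do rewrite sol_partialS// [in X in part b X]mxE partD part_LJ.
apply: cvgD; first exact: cvg_cst.
have [D D0 HD] := sol_term_le; have [B B0 HB] := ccont_on_normv cth.
(* All partial sums are bounded in norm by [D] times the sum of the majorant, and [th] by [B]; this
   gives a bound of [A *m sol_partial N s + th s] uniform in [N] and [s]. *)
apply: (@RLJ_dominated_cvg _ _ a01 t T _ _ (normm A * (D * limn (series majorant)) + B)) => //.
- move=> N.
  have /ccont_onP := ccont_onD (ccont_onM A (ccont_on_sol_partial N)) cth.
  exact.
- by have /ccont_onP := ccont_on_rhs; exact.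
- move=> N s; rewrite in_itv/= => sT.
  rewrite (le_trans (part_le_normv _ _ _))// (le_trans (normvD _ _))// lerD ?HB ?in_T//.
  rewrite (le_trans (normv_mul _ _))// ler_wpM2l ?normm_ge0//.
  rewrite (le_trans (normv_sum _ (sol_term ^~ s)))//.
  rewrite (@le_trans _ _ (\sum_(n < N) D * majorant n))//.
    by apply: ler_sum => n _; exact: HD.
  rewrite -mulr_sumr ler_wpM2l//.
  have -> : \sum_(n < N) majorant n = series majorant N by rewrite seriesEord.
  apply: nondecreasing_cvgn_le; last exact: is_cvg_series_majorant.
  apply/nondecreasing_seqP => n; rewrite seriesSr lerDl.
  exact: majorant_ge0.
- move=> s; rewrite in_itv/= => sT.
  have : ctends (fun N => A *m sol_partial N s + th s) (A *m x s + th s).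
    apply: ctendsD; last exact: ctends_cst.
    by apply: ctendsM; [exact: ctends_cst|exact: ctends_sol].
  by move=> /(_ b i 0).
Qed.

Lemma cintegrable_Lkernel y t : t <= T -> ccont_on T y ->
  cintegrable `[0, t] (fun s => (Lkernel a t s)%:C *: (y s : 'cV[R[i]]_d)).
Proof.
move=> tT /ccont_onP cy; apply/cintegrableP => b i.
under [X in _.-integrable _ X]eq_fun do rewrite mxE partZ.
exact: integrable_Lkernel_continuous (cy b i).
Qed.

Lemma sol0 : x 0 = x0.
Proof.
rewrite sol_integral_eq ?lexx//; apply/matrixP => i j; rewrite ord1; apply: partP => b.
by rewrite mxE partD part_LJ RLJ0 addr0.
Qed.

End Picard.

(** * The absolutely continuous case *)

Section convolution.
Context {R : realType}.
Local Notation mu := (@lebesgue_measure R).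
Implicit Types (P Q r : R -> R) (s t u tau T C : R).

(** Integrability is not assumed, because an inner integral [conv Q r t] may fail to converge
    absolutely at some [t]. *)
Lemma ge0_integralZl_measurable (k : R) (f : R -> \bar R) : 0 <= k ->
  measurable_fun setT f -> (\int[mu]_x (k%:E * f x) = k%:E * \int[mu]_x f x)%E.
Proof.
rewrite le_eqVlt => /orP[/eqP <- _|k0 mf].
  by rewrite mul0e integral0_eq// => x _; rewrite mul0e.
rewrite [in RHS]integralE [in LHS]integralE.
rewrite (ge0_funeposM _ (ltW k0)) (ge0_funenegM _ (ltW k0)).
have mp := measurable_funepos mf; have mn := measurable_funeneg mf.
rewrite (ge0_integralZl_EFin mu measurableT (fun x _ => funepos_ge0 f x) mp (ltW k0)).
rewrite (ge0_integralZl_EFin mu measurableT (fun x _ => funeneg_ge0 f x) mn (ltW k0)).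
have A0 : (0 <= \int[mu]_x f^\+ x)%E by apply: integral_ge0.
have B0 : (0 <= \int[mu]_x f^\- x)%E by apply: integral_ge0.
move: (integral _ _ _) (integral _ _ _) A0 B0 => [A||] [B||]//= A0 B0;
  rewrite ?(gt0_muley, gt0_muleNy, lte_fin)//= -?EFinM -?EFinN -?EFinD -?EFinM
   ?(gt0_muley, gt0_muleNy, lte_fin)//.
by rewrite mulrBr.
Qed.

(** Taken over the whole line: functions on [[0, T]] are extended by 0, which spares Fubini the
    triangular domain. *)
Definition conv P Q t : \bar R := (\int[mu]_s (P (t - s) * Q s)%:E)%E.

Lemma measurable_subl P t : measurable_fun setT P ->
  measurable_fun setT (fun s => P (t - s)).
Proof. by move=> mP; apply: (measurableT_comp mP); exact: measurable_funB. Qed.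

Lemma measurable_subr P t : measurable_fun setT P ->
  measurable_fun setT (fun s => P (s - t)).
Proof. by move=> mP; apply: (measurableT_comp mP); exact: measurable_funB. Qed.

Lemma measurable_conv_integrand P Q t : measurable_fun setT P ->
  measurable_fun setT Q -> measurable_fun setT (fun s => (P (t - s) * Q s)%:E).
Proof.
move=> mP mQ; apply/measurable_EFinP; apply: measurable_funM => //.
exact: measurable_subl.
Qed.

Lemma ge0_convC P Q t : measurable_fun setT P -> measurable_fun setT Q ->
  (forall u, 0 <= P u) -> (forall u, 0 <= Q u) -> conv P Q t = conv Q P t.
Proof.
move=> mP mQ P0 Q0; rewrite /conv.
have n1 : (-1 : R) != 0 by rewrite oppr_eq0 oner_eq0.
have pos s : (0 <= (P (t - s) * Q s)%:E)%E by rewrite lee_fin mulr_ge0.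
rewrite (ge0_integral_affine t n1 (measurable_conv_integrand t mP mQ) pos).
rewrite normrN normr1 mul1e; apply: eq_integral => s _.
by rewrite mulN1r opprD opprK addrC subrK addrC mulrC.
Qed.

(** Fubini. Integrating the absolute value over [t] first leaves [conv P Q (tau - s) * |r s|]. As
    [r] vanishes on negative numbers, only arguments up to [T] matter, where [conv P Q] is at most
    [C]; so the double integral is at most [|C|] times the L1 norm of [r]. *)
Lemma conv_assoc P Q r T C tau :
  measurable_fun setT P -> measurable_fun setT Q ->
  (forall u, 0 <= P u) -> (forall u, 0 <= Q u) ->
  mu.-integrable setT (EFin \o r) -> (forall s, s < 0 -> r s = 0) ->
  (forall u, u <= T -> (conv P Q u <= C%:E)%E) -> tau <= T ->
  mu.-integrable setT (fun t => (P (tau - t))%:E * conv Q r t)%E /\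
  (\int[mu]_t ((P (tau - t))%:E * conv Q r t) =
   \int[mu]_s (conv P Q (tau - s) * (r s)%:E))%E.
Proof.
move=> mP mQ P0 Q0 ir r0 PQC tauT.
have mr : measurable_fun setT r by move/integrableP : ir => [/measurable_EFinP].
pose F (z : R * R) : \bar R := (P (tau - z.1) * (Q (z.1 - z.2) * r z.2))%:E.
have mF : measurable_fun [set: R * R] F.
  apply/measurable_EFinP; apply: measurable_funM.
    by apply: (measurableT_comp mP); exact: measurable_funB.
  apply: measurable_funM; last exact: (measurableT_comp mr).
  by apply: (measurableT_comp mQ); exact: measurable_funB.
have inner s : (\int[mu]_t (P (tau - t) * Q (t - s))%:E = conv P Q (tau - s))%E.
  have o1 : (1 : R) != 0 by rewrite oner_eq0.
  have m1 : measurable_fun setT (fun t => (P (tau - t) * Q (t - s))%:E).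
    apply/measurable_EFinP; apply: measurable_funM; first exact: measurable_subl.
    exact: measurable_subr.
  have p1 t : (0 <= (P (tau - t) * Q (t - s))%:E)%E by rewrite lee_fin mulr_ge0.
  rewrite (ge0_integral_affine s o1 m1 p1) normr1 mul1e.
  apply: eq_integral => u _; rewrite mul1r addrK.
  by congr ((P _ * _)%:E); ring.
have F1 t : (\int[mu]_s F (t, s) = (P (tau - t))%:E * conv Q r t)%E.
  rewrite -ge0_integralZl_measurable//; last exact: measurable_conv_integrand.
have F2 s : (\int[mu]_t F (t, s) = conv P Q (tau - s) * (r s)%:E)%E.
  rewrite muleC.
  have [s0|s0] := ltP s 0.
    rewrite r0// mul0e integral0_eq// => t _.
    by rewrite /F/= r0// !mulr0.
  rewrite -(inner s) -integralZl//.
    by apply: eq_integral => t _; rewrite /F/= -EFinM; congr EFin; ring.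
  apply/integrableP; split.
    apply/measurable_EFinP; apply: measurable_funM; first exact: measurable_subl.
    exact: measurable_subr.
  under eq_integral do rewrite gee0_abs ?lee_fin ?mulr_ge0//.
  rewrite inner//; apply: (le_lt_trans (PQC _ _)); last exact: ltry.
  by rewrite lerBlDr (le_trans tauT)// lerDl.
have iF : (mu \x mu)%E.-integrable setT F.
  apply/integrable21ltyP => //.
  have Fa s : (\int[mu]_t `|F (t, s)| = conv P Q (tau - s) * `|r s|%:E)%E.
    rewrite muleC -(inner s) -ge0_integralZl_EFin//; last 2 first.
    - by move=> t _; rewrite lee_fin mulr_ge0.
    - apply/measurable_EFinP; apply: measurable_funM; first exact: measurable_subl.
      exact: measurable_subr.
    apply: eq_integral => t _; rewrite /F/= -EFinM; congr EFin.
    by rewrite !normrM (ger0_norm (P0 _)) (ger0_norm (Q0 _)); ring.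
  under eq_integral do rewrite Fa.
  have C0 : (0 <= `|C|%:E)%E by rewrite lee_fin.
  apply: (@le_lt_trans _ _ (\int[mu]_s (`|C|%:E * `|(EFin \o r) s|))%E).
    apply: ge0_le_integral => //.
    - by move=> s _; rewrite mule_ge0// integral_ge0// => t _; rewrite lee_fin mulr_ge0.
    - have := @measurable_fun_fubini_tonelli_G _ _ _ _ R mu (abse \o F).
      rewrite /fubini_G/=; under eq_fun do rewrite Fa; apply => //.
      by apply: measurableT_comp.
    - apply/measurable_EFinP; apply: measurable_funM => //.
      exact: measurableT_comp.
    - move=> s _; have [s0|s0] := ltP s 0; first by rewrite /= r0// normr0 !mule0.
      apply: lee_wpmul2r => //; apply: (le_trans (PQC _ _)).
        by rewrite lerBlDr (le_trans tauT)// lerDl.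
      by rewrite lee_fin ler_norm.
  rewrite ge0_integralZl_EFin//; last by apply: measurableT_comp => //; exact/measurable_EFinP.
  by apply: lte_mul_pinfty => //; case/integrableP : ir.
split.
  have := integrable_fubini_F iF; rewrite /fubini_F.
  by under eq_fun do rewrite F1.
have := Fubini iF.
by under eq_integral do rewrite F1; under [X in _ = X -> _]eq_integral do rewrite F2.
Qed.

End convolution.

Section integral_uniqueness.
Context {R : realType}.
Local Notation mu := (@lebesgue_measure R).

(** By Lebesgue differentiation each function is almost everywhere the derivative of its primitive.
    The strict bound [t < T] leaves a neighbourhood of [t] on which the primitives agree. *)
Lemma ae_eq_of_integral (T : R) (f g : R -> R) :
  mu.-integrable setT (EFin \o f) -> mu.-integrable setT (EFin \o g) ->
  (forall t, t <= T -> \int[mu]_(s in `]-oo, t]) f s = \int[mu]_(s in `]-oo, t]) g s) ->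
  {ae mu, forall t, t < T -> f t = g t}.
Proof.
move=> iF iG fg.
have loc (h : R -> R) : mu.-integrable setT (EFin \o h) -> locally_integrable setT h.
  by move=> ih; have := integrable_locally measurableT ih; rewrite patch_setT.
have iNy (h : R -> R) : mu.-integrable setT (EFin \o h) ->
    forall y, mu.-integrable `]-oo, y] (EFin \o h).
  by move=> ih y; apply: integrableS ih.
have := FTC1Ny (iNy _ iF) (loc _ iF); have := FTC1Ny (iNy _ iG) (loc _ iG).
apply: (@filterS2 _ _ (ae_filter_ringOfSetsType mu)) => t [_ <-] [_ <-] tT.
rewrite !derive1E; apply: near_eq_derive.
near=> s; apply: fg; apply/ltW; near: s.
exact: lt_nbhsl.
Unshelve. all: by end_near. Qed.

End integral_uniqueness.

(** * Riemann-Liouville kernels and their convolutions *)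

Section power_kernel.
Context {R : realType}.
Local Notation mu := (@lebesgue_measure R).
Implicit Types (p q s t u T : R) (r : R -> R).

(** The Riemann-Liouville kernel of order [p] without its factor [1 / Gamma p]. For [p = 1] it is
    the indicator of the half-line, and convolving with it is taking a primitive. *)
Definition powk p u : R := if 0 <= u then u `^ (p - 1) else 0.

Lemma powk_ge0 p u : 0 <= powk p u.
Proof. by rewrite /powk; case: ifP => // _; exact: powR_ge0. Qed.

Lemma powk1 u : powk 1 u = if 0 <= u then 1 else 0.
Proof. by rewrite /powk subrr powRr0. Qed.

Lemma measurable_powk p : measurable_fun setT (powk p).
Proof.
rewrite (_ : powk p = (fun u => u `^ (p - 1)) \_ `[0, +oo[).
  by apply/(measurable_restrictT _ _).1 => //; exact: measurable_funTS.
by apply/funext => u; rewrite patchE mem_setE in_itv/= andbT.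
Qed.

Lemma conv_powk_restrict p T t r : t <= T ->
  (conv (powk p) (r \_ `[0%R, T]) t =
   \int[mu]_(s in `[0%R, t]) ((t - s) `^ (p - 1) * r s)%:E)%E.
Proof.
move=> tT; rewrite [RHS]integral_mkcond; apply: eq_integral => s _.
rewrite /powk !patchE !mem_setE !in_itv/= subr_ge0.
have [st|st] := leP s t; last by rewrite andbF mul0r.
by rewrite (le_trans st tT) andbT; case: ifP => // _; rewrite mulr0.
Qed.

Lemma conv_powk p q t : conv (powk p) (powk q) t = betaE p q t.
Proof.
rewrite -(@integral_eq_beta_ker R p q t (fun s => (t - s) `^ (p - 1) * s `^ (q - 1)))//.
- rewrite [RHS]integral_mkcond; apply: eq_integral => s _.
  rewrite /powk patchE mem_setE in_itv/= subr_ge0.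
  by case: (leP s t) => st; case: (leP 0 s) => s0 //=; rewrite ?mulr0 ?mul0r.
- by apply: measurable_funM; [exact: measurable_powRB|exact: measurable_funTS].
Qed.

Lemma betaE_le0 p q t : t <= 0 -> betaE p q t = 0%E.
Proof.
move=> t0; rewrite /betaE integral0_eq// => s _; rewrite /beta_ker.
by case: ifP => // /andP[s0 st]; move: (lt_le_trans (lt_trans s0 st) t0); rewrite ltxx.
Qed.

(** [1 <= p + q] makes the exponent of [t ^ (p + q - 1)] nonnegative, which keeps it bounded near
    0. *)
Lemma betaE_bounded p q T : 0 < p -> 0 < q -> 1 <= p + q ->
  exists C, forall t, t <= T -> (betaE p q t <= C%:E)%E.
Proof.
move=> p0 q0 pq; have B0 : 0 <= Gamma p * Gamma q / Gamma (p + q).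
  by rewrite divr_ge0 ?mulr_ge0 ?ltW ?Gamma_gt0 ?addr_gt0.
exists (T `^ (p + q - 1) * (Gamma p * Gamma q / Gamma (p + q))) => t tT.
have [t0|t0] := ltP 0 t; last first.
  rewrite betaE_le0// lee_fin.
  by apply: mulr_ge0 => //; exact: powR_ge0.
rewrite betaE_GammaE// lee_fin ler_wpM2r// ge0_ler_powR ?nnegrE ?subr_ge0//.
- exact: ltW.
- exact: le_trans (ltW t0) tT.
Qed.

End power_kernel.

Section integrable_fine.
Context {R : realType}.
Local Notation mu := (@lebesgue_measure R).

Lemma integrable_restrictT (D : set R) (f : R -> R) : measurable D ->
  mu.-integrable D (EFin \o f) -> mu.-integrable setT (EFin \o (f \_ D)).
Proof. move=> mD ifD; rewrite -restrict_EFin.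
by have [h _] := @integrable_mkcond _ _ _ mu D (EFin \o f) mD; exact: h. Qed.

(** An integrable convolution may still be infinite on a null set; [fine] replaces these values by 0
    and changes no integral. *)
Lemma integrable_EFin_fine (E : R -> \bar R) : mu.-integrable setT E ->
  mu.-integrable setT (EFin \o (fine \o E)) /\
  forall D, measurable D -> (\int[mu]_(t in D) (fine (E t))%:E = \int[mu]_(t in D) E t)%E.
Proof.
move=> iE; have mE := measurable_int mu iE.
have ae : {ae mu, forall t, E t = (fine (E t))%:E}.
  have := integrable_ae measurableT iE.
  by apply: filterS => t /= /(_ I) fE; rewrite fineK.
have mf : measurable_fun setT (EFin \o (fine \o E)).
  by apply/measurable_EFinP; exact: measurableT_comp.
split.
  move/integrableP : iE => [_ iE]; apply/integrableP; split => //.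
  rewrite (@ae_eq_integral _ _ _ mu setT (abse \o E)) //.
  - exact: measurableT_comp.
  - exact: measurableT_comp.
  by apply: (@filterS _ _ (ae_filter_ringOfSetsType mu) _ _ _ ae) => t /= + _ => {2}->.
move=> D mD; apply: ae_eq_integral => //.
- exact: measurable_funTS mf.
- exact: measurable_funTS mE.
by apply: (@filterS _ _ (ae_filter_ringOfSetsType mu) _ _ _ ae) => t /= + _ => <-.
Qed.

End integrable_fine.

(** * The Caputo derivative almost everywhere *)

Section caputo_ae.
Context {R : realType}.
Local Notation mu := (@lebesgue_measure R).
Variables (a T : R).
Hypotheses (a01 : 0 < a < 1) (T0 : 0 < T).
Implicit Types (s t : R) (g X phi : R -> R).

Let a0 : 0 < a. Proof. by case/andP: a01. Qed.
Let a1 : 0 < 1 - a. Proof. by have /andP[_] := a01; rewrite subr_gt0. Qed.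
Let a2 : 0 < 2 - a. Proof. by have := a1; lra. Qed.

Let c : R := (Gamma a * Gamma (2 - a))^-1.

Lemma integrable_powRM g : {within `[0, T], continuous g} ->
  mu.-integrable setT (EFin \o ((fun s => c * (s `^ (1 - a) * g s)) \_ `[0, T])).
Proof.
move=> cg; apply: integrable_restrictT => //.
have [M M0 gM] := within_continuous_bounded cg.
apply: measurable_bounded_integrable => //.
- by rewrite [X in (X < _)%E](lebesgue_measure_itv `[0, T])/= lte_fin T0 -EFinB ltry.
- apply: measurable_funM => //; apply: measurable_funM; first exact: measurable_funTS.
  exact: within_continuous_measurable.
- exists (`|c| * (T `^ (1 - a) * M)); split; first exact: num_real.
  move=> N MN s /= sT; apply/ltW/le_lt_trans/MN; rewrite normrM ler_wpM2l// normrM.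
  have /andP[s0 sT'] : 0 <= s <= T by move: sT; rewrite in_itv.
  apply: ler_pM => //; last exact: gM.
  rewrite ger0_norm ?powR_ge0// ge0_ler_powR ?nnegrE ?(ltW a1)//.
  exact: ltW.
Qed.

(** Moving [s ^ (1 - a)] from the kernel to the function turns the L-integral into a genuine
    convolution. *)
Lemma conv_powk_RLJ g t : t <= T -> {within `[0, T], continuous g} ->
  conv (powk a) ((fun s => c * (s `^ (1 - a) * g s)) \_ `[0, T]) t = (RLJ a g t)%:E.
Proof.
move=> tT cg; rewrite conv_powk_restrict//.
have ig := integrable_Lkernel_continuous a01 tT cg.
rewrite /RLJ -/c EFinM fineK ?integrable_fin_num// -(integralZl _ ig)//.
by apply: eq_integral => s _; rewrite -EFinM /Lkernel; congr EFin; ring.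
Qed.

Lemma caputo_ae g X phi : {within `[0, T], continuous g} ->
  mu.-integrable `[0, T] (EFin \o phi) ->
  (forall t, 0 <= t <= T -> X t = X 0 + \int[mu]_(s in `[0, t]) phi s) ->
  (forall t, 0 <= t <= T -> X t = X 0 + RLJ a g t) ->
  {ae mu, forall t, 0 <= t < T -> \int[mu]_(s in `[0, t]) ((t - s) `^ (- a) * phi s) =
    Gamma (1 - a) / Gamma (2 - a) * (t `^ (1 - a) * g t)}.
Proof.
move=> cg iphi Xphi Xg.
pose phiT := phi \_ `[0, T]; pose w := (fun s => c * (s `^ (1 - a) * g s)) \_ `[0, T].
have iphiT : mu.-integrable setT (EFin \o phiT).
  exact: integrable_restrictT.
have iw : mu.-integrable setT (EFin \o w) by exact: integrable_powRM.
have neg (f : R -> R) s : s < 0 -> (f \_ `[0, T]) s = 0.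
  by move=> s0; rewrite patchE mem_setE in_itv/= leNgt s0.
have mk p := @measurable_powk R p; have k0 p := @powk_ge0 R p.
have [C1 HC1] : exists C, forall u, u <= T -> (conv (powk 1) (powk (1 - a)) u <= C%:E)%E.
  have [|C HC] := @betaE_bounded R 1 (1 - a) T ltr01 a1; first by have := a1; lra.
  by exists C => u uT; rewrite conv_powk HC.
have [C2 HC2] : exists C, forall u, u <= T -> (conv (powk (1 - a)) (powk 1) u <= C%:E)%E.
  by exists C1 => u uT; rewrite ge0_convC// HC1.
have [C3 HC3] : exists C, forall u, u <= T -> (conv (powk (1 - a)) (powk a) u <= C%:E)%E.
  have [|C HC] := @betaE_bounded R (1 - a) a T a1 a0; first by rewrite subrK.
  by exists C => u uT; rewrite conv_powk HC.
have A1 tau tT := @conv_assoc R (powk 1) (powk (1 - a)) phiT T C1 tau (mk _) (mk _)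
  (k0 _) (k0 _) iphiT (neg _) HC1 tT.
have A2 tau tT := @conv_assoc R (powk (1 - a)) (powk 1) phiT T C2 tau (mk _) (mk _)
  (k0 _) (k0 _) iphiT (neg _) HC2 tT.
have A3 tau tT := @conv_assoc R (powk (1 - a)) (powk a) w T C3 tau (mk _) (mk _)
  (k0 _) (k0 _) iw (neg _) HC3 tT.
pose H := conv (powk (1 - a)) phiT.
(* [H] is cut off after [T]. The result is the integrand of [A1] at [tau = T], whose integrability
   on the whole line comes with that associativity. *)
pose E t : \bar R := ((powk 1 (T - t))%:E * H t)%E.
have EH t : t <= T -> E t = H t.
  by move=> tT; rewrite /E powk1 subr_ge0 tT mul1e.
(* [X t - X 0] is both a primitive of [phi] and the L-integral of [g]; here the two are compared as
   convolutions, both 0 for [t < 0]. *)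
have conv1 t : t <= T -> conv (powk 1) phiT t = conv (powk a) w t.
  move=> tT; rewrite (conv_powk_RLJ tT cg) conv_powk_restrict//.
  have [t0|t0] := ltP t 0.
    by rewrite RLJ_lt0// set_itv_ge ?bnd_simp -?ltNge// integral_set0.
  have tT' : 0 <= t <= T by rewrite t0.
  have XE : RLJ a g t = \int[mu]_(s in `[0, t]) phi s.
    by have := Xg t tT'; rewrite Xphi// => /addrI.
  rewrite XE fineK.
    by apply: eq_integral => s _; rewrite subrr powRr0 mul1r.
  apply: integrable_fin_num => //; apply: integrableS iphi => //.
  by move=> s /=; rewrite !in_itv/= => /andP[->]; move=> /le_trans; apply.
(* The orders [1 - a] and [a] add up to 1, so the convolution of the two kernels is constant on
   positive numbers, equal to the Beta value [k]. *)
pose k := Gamma (1 - a) * Gamma a.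
have convk u : 0 < u -> conv (powk (1 - a)) (powk a) u = k%:E.
  move=> u0; rewrite conv_powk betaE_GammaE// subrK Gamma1 divr1.
  by rewrite subrr powRr0 mul1r.
have HE tau : tau <= T ->
    (\int[mu]_(t in `]-oo, tau]) H t = \int[mu]_(t in `]-oo, tau]) (k * w t)%:E)%E.
  move=> tauT; transitivity (\int[mu]_t ((powk 1 (tau - t))%:E * H t))%E.
    rewrite integral_mkcond; apply: eq_integral => t _.
    rewrite patchE mem_setE in_itv/= powk1 subr_ge0.
    by case: ifP => _; rewrite ?mul1e ?mul0e.
  rewrite (A1 _ tauT).2.
  (* Commuting the kernels of orders 1 and [1 - a] brings the primitive of [phi] inside, where
     [conv1] can replace it. *)
  under eq_integral do rewrite ge0_convC//.
  rewrite -(A2 _ tauT).2.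
  transitivity (\int[mu]_t ((powk (1 - a) (tau - t))%:E * conv (powk a) w t))%E.
    apply: eq_integral => t _; have [tt|tt] := leP t tau.
      by rewrite conv1// (le_trans tt).
    by rewrite /powk subr_ge0 leNgt tt !mul0e.
  rewrite (A3 _ tauT).2.
  have mw : measurable_fun setT (fun t => (k * w t)%:E).
    apply/measurable_EFinP; apply: measurable_funM => //.
    by move/integrableP : iw => [/measurable_EFinP].
  rewrite -(@integral_itv_bndo_bndc R -oo%O tau); last exact: measurable_funTS mw.
  rewrite [RHS]integral_mkcond; apply: eq_integral => s _.
  rewrite patchE mem_setE in_itv/=; case: ifPn => [st|].
    by rewrite convk ?subr_gt0.
  by rewrite -leNgt => ts; rewrite conv_powk betaE_le0 ?subr_le0// mul0e.
have [iE fE] := integrable_EFin_fine (A1 T (lexx T)).1.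
have ikw : mu.-integrable setT (EFin \o (fun t => k * w t)).
  rewrite (_ : EFin \o _ = (fun u => k%:E * (EFin \o w) u)%E).
    exact: integrableZl.
  by apply/funext => u /=; rewrite EFinM.
have := ae_eq_of_integral iE ikw (T := T).
move=> aeq.
have {}aeq : {ae mu, forall t, t < T -> fine (E t) = k * w t}.
  apply: aeq => tau tauT; rewrite /Rintegral; congr fine.
  rewrite -(HE _ tauT) (fE `]-oo, tau]%classic)//.
  apply: eq_integral => t; rewrite mem_setE in_itv/= => tt.
  exact: EH (le_trans tt tauT).
apply: (@filterS _ _ (ae_filter_ringOfSetsType mu) _ _ _ aeq) => t + /andP[t0 tT].
move=> /(_ tT); rewrite EH ?(ltW tT)// /H conv_powk_restrict ?(ltW tT)// => h.
transitivity (k * w t).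
  rewrite -h /Rintegral; congr fine; apply: eq_integral => s _.
  by rewrite (_ : 1 - a - 1 = - a)//; ring.
rewrite /w patchE mem_setE in_itv/= t0 (ltW tT)/= /k /c.
have := Gamma_gt0 a0 => /lt0r_neq0; have := Gamma_gt0 a2 => /lt0r_neq0.
move: (Gamma a) (Gamma (2 - a)) (Gamma (1 - a)) => G1 G2 G3 G20 G10.
by field; rewrite G10 G20.
Qed.

End caputo_ae.

(** * The power series case *)

Section absolutely_convergent_power_series.
Context {R : realType}.
Local Notation mu := (@lebesgue_measure R).
Implicit Types (c : R^nat) (s t K T : R).

Definition abs_pser c T := cvgn (series (fun n => `|c n| * T ^+ n)).

Lemma abs_pser_le c s T : 0 <= s <= T -> abs_pser c T -> abs_pser c s.
Proof.
move=> /andP[s0 sT]; apply: series_le_cvg => n.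
- by rewrite mulr_ge0// exprn_ge0.
- by rewrite mulr_ge0// exprn_ge0// (le_trans s0).
- by rewrite ler_wpM2l// lerXn2r// nnegrE (le_trans s0).
Qed.

Lemma is_cvg_abs_pser c s : 0 <= s -> abs_pser c s -> cvgn (pseries c s).
Proof.
move=> s0; apply: is_cvg_series_le_norm => n.
by rewrite normrM normrX (ger0_norm s0).
Qed.

Lemma is_cvg_series_shift1 (u : R^nat) : cvgn (series u) -> cvgn (series (fun n => u n.+1)).
Proof.
move=> cu; rewrite (_ : series _ = (fun n => series u n.+1 - u 0%N)).
  apply: is_cvgB; last exact: is_cvg_cst.
  have h : [sequence series u n.+1]_n @ \oo --> limn (series u) by rewrite cvg_shiftS.
  exact: cvgP h.
by apply/funext => n; rewrite /series/= [in RHS]big_nat_recl//= [RHS]addrC addKr.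
Qed.

(** [z ^+ n] is the smallest of [z ^+ 0, ..., z ^+ n], so the left side is at most the geometric
    sum. *)
Lemma mulSn_expr_le n (z : R) : 0 <= z < 1 -> n.+1%:R * z ^+ n <= (1 - z)^-1.
Proof.
move=> /andP[z0 z1]; have z1' : 0 < 1 - z by rewrite subr_gt0.
rewrite -(ler_pM2r z1') mulVf ?gt_eqF//.
apply: (@le_trans _ _ (1 - z ^+ n.+1)); last by rewrite gerBl exprn_ge0.
rewrite -[1 - z ^+ _]opprB subrX1 -mulNr opprB mulrC ler_wpM2l ?(ltW z1')//.
rewrite mulr_natl -[in X in X <= _](card_ord n.+1) -sumr_const ler_sum// => i _.
by rewrite ler_wiXn2l ?(ltW z1)// -ltnS.
Qed.

(** The factor [n + 1] of the formal derivative is absorbed by shrinking the radius: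
    [(n + 1) * (K / T) ^ n] is bounded. *)
Lemma abs_pser_diffs c K T : 0 <= K < T -> abs_pser c T -> abs_pser (pseries_diffs c) K.
Proof.
move=> /andP[K0 KT] cT; have T0 : 0 < T := le_lt_trans K0 KT.
have z01 : 0 <= K / T < 1 by rewrite divr_ge0 ?(ltW T0)//= ltr_pdivrMr// mul1r.
pose C := (1 - K / T)^-1 / T.
have C0 : 0 <= C.
  by rewrite divr_ge0 ?(ltW T0)// invr_ge0 subr_ge0 ltW//; case/andP: z01.
apply: (@series_le_cvg _ _ (fun n => C * (`|c n.+1| * T ^+ n.+1))).
- by move=> n; rewrite mulr_ge0// exprn_ge0.
- by move=> n; rewrite mulr_ge0// mulr_ge0// exprn_ge0// ltW.
- move=> n; rewrite /pseries_diffs normrM normr_nat.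
  have -> : C * (`|c n.+1| * T ^+ n.+1) = (1 - K / T)^-1 * (`|c n.+1| * T ^+ n).
    by rewrite /C exprS; field; rewrite gt_eqF// subr_eq0 gt_eqF//= gt_eqF.
  have -> : n.+1%:R * `|c n.+1| * K ^+ n = n.+1%:R * (K / T) ^+ n * (`|c n.+1| * T ^+ n).
    by rewrite expr_div_n; field; rewrite expf_neq0// gt_eqF.
  by rewrite ler_wpM2r ?mulSn_expr_le// mulr_ge0// exprn_ge0// ltW.
rewrite (_ : (fun n => _) = C *: (fun n => `|c n.+1| * T ^+ n.+1)) //.
apply: is_cvg_seriesZ; exact: (is_cvg_series_shift1 cT).
Qed.

Lemma derive1_pser c (X : R -> R) T s : 0 < s < T -> abs_pser c T ->
  {in `]0, T[, forall t, X t = limn (pseries c t)} ->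
  derive1 X s = limn (pseries (pseries_diffs c) s).
Proof.
move=> /andP[s0 sT] cT XE.
(* Termwise differentiation is available if the series and its first two formal derivatives converge
   at a point beyond [s]. Each formal derivative costs some radius, from [T] to [K1] and from [K1]
   to [K2]. *)
pose K1 := (s + T) / 2; pose K2 := (s + K1) / 2.
have K1T : s < K1 < T by rewrite /K1; apply/andP; split; lra.
have K21 : s < K2 < K1 by move: K1T => /andP[? ?]; rewrite /K2; apply/andP; split; lra.
have [[sK1 K1T'] [sK2 K2K1]] := (andP K1T, andP K21).
have p1 : 0 <= K1 < T by rewrite K1T' (ltW (lt_trans s0 sK1)).
have p2 : 0 <= K2 < K1 by rewrite K2K1 (ltW (lt_trans s0 sK2)).
have d1 := abs_pser_diffs p1 cT; have d2 := abs_pser_diffs p2 d1.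
have [K20 _] := andP p2.
have c0 : abs_pser c K2 by apply: abs_pser_le cT; rewrite K20 (ltW (lt_trans K2K1 K1T')).
have c1 : abs_pser (pseries_diffs c) K2 by apply: abs_pser_le d1; rewrite K20 (ltW K2K1).
have := @pseries_snd_diffs R c K2 s (is_cvg_abs_pser K20 c0) (is_cvg_abs_pser K20 c1)
  (is_cvg_abs_pser K20 d2).
rewrite !ger0_norm// ?(ltW s0)// => /(_ sK2) [_ <-].
rewrite derive1E; apply: near_eq_derive; near=> u; apply: XE.
rewrite in_itv/=; apply/andP; split; near: u.
- exact: lt_nbhsr.
- exact: lt_nbhsl.
Unshelve. all: by end_near. Qed.

(** The sum [G] of the absolute values dominates all partial sums, and Tonelli identifies its
    integral with the convergent series of the hypothesis. *)
Lemma Rintegral_series (D : set R) (f : nat -> R -> R) (F : R -> R) :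
  measurable D -> (forall n, mu.-integrable D (EFin \o f n)) ->
  (forall s, D s -> series (f ^~ s) n @[n --> \oo] --> F s) ->
  cvgn (series (fun n => \int[mu]_(s in D) `|f n s|)) ->
  measurable_fun D F /\
  \int[mu]_(s in D) F s = limn (series (fun n => \int[mu]_(s in D) f n s)).
Proof.
move=> mD iF cF cI.
have mf n : measurable_fun D (f n) by have /integrableP[/measurable_EFinP] := iF n.
have mS n : measurable_fun D (fun s => (series (f ^~ s) n)%:E).
  apply/measurable_EFinP; rewrite /series/=.
  by apply: measurable_sum => i.
have cE s : D s -> (series (f ^~ s) n)%:E @[n --> \oo] --> (F s)%:E.
  by move=> Ds; apply: cvg_EFin; [exact: nearW|exact: cF].
have mF : measurable_fun D (EFin \o F).
  exact: (emeasurable_fun_cvg (fun n s => (series (f ^~ s) n)%:E)).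
split; first exact/measurable_EFinP.
have mfa n : measurable_fun D (fun s => (`|f n s|)%:E).
  by apply/measurable_EFinP; apply: measurableT_comp.
pose G s : \bar R := (\sum_(n <oo) (`|f n s|)%:E)%E.
have G0 s : (0 <= G s)%E by apply: nneseries_ge0 => n _ _; rewrite lee_fin.
have mG : measurable_fun D G by apply: ge0_emeasurable_sum.
have iG : mu.-integrable D G.
  apply/integrableP; split => //.
  under eq_integral do rewrite gee0_abs//.
  rewrite /G integral_nneseries//.
  have EI n : (\int[mu]_(s in D) (`|f n s|)%:E = (\int[mu]_(s in D) `|f n s|)%:E)%E.
    by rewrite fineK// integrable_fin_num//; exact: (integrable_norm (iF n)).
  under eq_eseriesr do rewrite EI.
  rewrite (_ : (fun n => _) = EFin \o series (fun n => \int[mu]_(s in D) `|f n s|)).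
    by rewrite EFin_lim// ltry.
  by apply/funext => n; rewrite /= sumEFin.
have SG : {ae mu, forall s n, D s -> (`|(series (f ^~ s) n)%:E| <= G s)%E}.
  apply: aeW => s n Ds.
  apply: (@le_trans _ _ (\sum_(0 <= i < n) (`|f i s|)%:E)%E).
    by rewrite sumEFin lee_fin; exact: ler_norm_sum.
  exact: nneseries_lim_ge.
have cae : {ae mu, forall s, D s ->
    (series (f ^~ s) n)%:E @[n --> \oo] --> (EFin \o F) s} by exact: aeW.
have [iF' _ H] := @dominated_convergence _ _ R mu D mD _ _ G mS mF cae iG SG.
apply/esym/cvg_lim => //.
rewrite (_ : series _ = fine \o (fun n => \int[mu]_(s in D) (series (f ^~ s) n)%:E)%E).
  apply: fine_cvg; rewrite fineK; first exact: H.
  exact: integrable_fin_num.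
apply/funext => n; rewrite /= /series/=.
under eq_integral do rewrite -sumEFin.
rewrite integral_sum// -sum_fine//.
by move=> i _; apply: integrable_fin_num => //; exact: iF.
Qed.

End absolutely_convergent_power_series.

(** * The Caputo derivative of a power series *)

Section caputo_power_series.
Context {R : realType}.
Local Notation mu := (@lebesgue_measure R).
Variables (a T : R).
Hypotheses (a01 : 0 < a < 1) (T0 : 0 < T).
Implicit Types (s t : R) (g X : R -> R) (gam : R^nat).

Let a0 : 0 < a. Proof. by case/andP: a01. Qed.
Let a1 : 0 < 1 - a. Proof. by have /andP[_] := a01; rewrite subr_gt0. Qed.
Let a2 : 0 < 2 - a. Proof. by have := a1; lra. Qed.

Lemma RLJ_partial_series gam N t : 0 <= t <= T ->
  RLJ a (fun s => series (fun n => gam n * s ^+ n) N) t =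
  series (fun n => gam n * L_beta a n * t ^+ n.+1) N.
Proof.
move=> /andP[t0 tT]; rewrite seriesEord /=.
rewrite (_ : (fun s => _) = (fun s => \sum_(i < N) gam i * s ^+ i)); last first.
  by apply/funext => s; rewrite seriesEord.
have cX n : {within `[0, T], continuous (fun s : R => s ^+ n)}.
  exact: (continuous_subspaceT (@exprn_continuous R n)).
rewrite (@RLJ_sum _ _ a01 T t 'I_N (fun i s => gam i * s ^+ i))//; last first.
  by move=> n; exact: within_continuousZ.
apply: eq_bigr => n _.
by rewrite (RLJZ a01 _ tT)// RLJXn// mulrA.
Qed.

Lemma RLJ_pser g gam : {within `[0, T], continuous g} -> abs_pser gam T ->
  {in `[0, T], forall s, g s = limn (pseries gam s)} ->
  {in `[0, T], forall t, RLJ a g t = limn (series (fun n => gam n * L_beta a n * t ^+ n.+1))}.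
Proof.
move=> cg gT gE t; rewrite in_itv/= => tT; have [t0 tT'] := andP tT.
apply/esym/cvg_lim => //.
rewrite (_ : series _ = fun N => RLJ a (fun s => series (fun n => gam n * s ^+ n) N) t); last first.
  by apply/funext => N; rewrite RLJ_partial_series.
apply: (RLJ_dominated_cvg a01 (T := T) (C := limn (series (fun n => `|gam n| * T ^+ n)))) => //.
- move=> N; rewrite (_ : (fun s => _) = (fun s => \sum_(i < N) gam i * s ^+ i)); last first.
    by apply/funext => s; rewrite seriesEord.
  apply: within_continuous_sumr => n; apply: within_continuousZ.
  exact: (continuous_subspaceT (@exprn_continuous R n)).
- move=> N s; rewrite in_itv/= => /andP[s0 sT].
  apply: (@le_trans _ _ (series (fun n => `|gam n| * T ^+ n) N)).
    rewrite /series/= (le_trans (ler_norm_sum _ _ _))// ler_sum// => n _.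
    rewrite normrM normrX (ger0_norm s0) ler_wpM2l// lerXn2r// nnegrE.
    exact: le_trans s0 sT.
  apply: nondecreasing_cvgn_le => //; apply/nondecreasing_seqP => n.
  by rewrite seriesSr lerDl mulr_ge0// exprn_ge0// ltW.
- move=> s sT; rewrite gE//; apply: is_cvg_abs_pser.
    by move: sT; rewrite in_itv/= => /andP[].
  by apply: abs_pser_le gT; move: sT; rewrite in_itv.
Qed.

(** The expansion of [X 0 + RLJ a g] when [g] has coefficients [gam]. Reading the coefficients of
    [X] off the integral equation ties them to those of [g] without comparing power series. *)
Definition sol_coef X gam n : R := if n is m.+1 then gam m * L_beta a m else X 0.

Lemma abs_pser_sol_coef X gam : abs_pser gam T -> abs_pser (sol_coef X gam) T.
Proof.
move=> gT; rewrite /abs_pser.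
have cT : cvgn (series (fun n => T * (`|gam n| * T ^+ n))).
  rewrite (_ : (fun n => _) = T *: (fun n => `|gam n| * T ^+ n))//.
  exact: is_cvg_seriesZ.
have c1 : cvgn (series (fun n => `|sol_coef X gam n.+1| * T ^+ n.+1)).
  apply: series_le_cvg cT => n /=.
  - by rewrite mulr_ge0// exprn_ge0// ltW.
  - by rewrite mulr_ge0 ?(ltW T0)// mulr_ge0// exprn_ge0// ltW.
  rewrite exprS mulrCA ler_wpM2l ?(ltW T0)// ler_wpM2r ?exprn_ge0 ?(ltW T0)//.
  by rewrite normrM ler_piMr// ger0_norm ?L_beta_le1// ltW// L_beta_gt0.
pose u n := `|sol_coef X gam n| * T ^+ n.
suff : series u @ \oo --> u 0%N + limn (series (fun n => u n.+1)) by exact: cvgP.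
rewrite -cvg_shiftS.
rewrite (_ : [sequence _]_n = fun n => u 0%N + series (fun n => u n.+1) n).
  by apply: cvgD => //; exact: cvg_cst.
by apply/funext => n; rewrite /series/= big_nat_recl.
Qed.

Lemma pser_sol_coef X g gam : {within `[0, T], continuous g} -> abs_pser gam T ->
  {in `[0, T], forall s, g s = limn (pseries gam s)} ->
  (forall t, 0 <= t <= T -> X t = X 0 + RLJ a g t) ->
  {in `[0, T], forall t, X t = limn (pseries (sol_coef X gam) t)}.
Proof.
move=> cg gT gE XE t tT; have tT' : 0 <= t <= T by move: tT; rewrite in_itv.
have cS := is_cvg_abs_pser (andP tT').1 (abs_pser_le tT' (@abs_pser_sol_coef X gam gT)).
rewrite XE// (RLJ_pser cg gT gE tT).
apply/esym/cvg_lim => //; rewrite -cvg_shiftS.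
rewrite (_ : [sequence _]_n = fun n => X 0 + series (fun n => gam n * L_beta a n * t ^+ n.+1) n).
  apply: cvgD; first exact: cvg_cst.
  have := is_cvg_series_shift1 cS; exact.
apply/funext => n; rewrite /pseries /series/= big_nat_recl//=.
by rewrite mulr1.
Qed.

Lemma caputo_pser X g gam t : {within `[0, T], continuous g} -> abs_pser gam T ->
  {in `[0, T], forall s, g s = limn (pseries gam s)} ->
  (forall t, 0 <= t <= T -> X t = X 0 + RLJ a g t) -> 0 < t <= T ->
  \int[mu]_(s in `[0, t]) ((t - s) `^ (- a) * derive1 X s) =
    Gamma (1 - a) / Gamma (2 - a) * (t `^ (1 - a) * g t).
Proof.
move=> cg gT gE XE /andP[t0 tT].
have XP := pser_sol_coef cg gT gE XE.
have eT := @abs_pser_sol_coef X gam gT.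
(* The L-integral followed by differentiation multiplies the n-th coefficient by [q n]. By [Ik], the
   Caputo kernel integrates [s ^+ n] to [c * t ^+ n / q n], so [q n] cancels and [c] times the
   series of [g] remains. *)
pose q n : R := n.+1%:R * L_beta a n.
have q0 n : 0 <= q n by rewrite mulr_ge0// ltW// L_beta_gt0.
pose f n s : R := (t - s) `^ (- a) * (gam n * q n * s ^+ n).
have in_0T s : 0 < s < t -> 0 < s < T by move=> /andP[-> /lt_le_trans]; apply.
have d1 s : 0 < s < t -> derive1 X s = limn (series (fun n => gam n * q n * s ^+ n)).
  move=> st; rewrite (@derive1_pser _ (sol_coef X gam) X T s)//.
  - congr (limn (series _)); apply/funext => n.
    by rewrite /pseries_diffs /= /q; ring.
  - exact: in_0T.
  - move=> u; rewrite in_itv/= => /andP[u0 uT]; apply: XP.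
    by rewrite in_itv/= !ltW.
have cd s : 0 < s < t -> cvgn (series (fun n => gam n * q n * s ^+ n)).
  move=> st; have /andP[s0 sT] := in_0T _ st.
  have := @abs_pser_diffs _ (sol_coef X gam) s T _ eT; rewrite (ltW s0) sT => /(_ isT).
  move=> /(is_cvg_abs_pser (ltW s0)); rewrite /pseries.
  rewrite (_ : (fun _ => _) = (fun n => gam n * q n * s ^+ n))//.
  by apply/funext => n; rewrite /pseries_diffs /= /q; ring.
pose k n s : R := (t - s) `^ (- a) * s ^+ n.
have mk n (D : set R) : measurable_fun D (k n).
  by apply: measurable_funM; [exact: measurable_powRB|exact: measurable_funTS].
have k0 n s : 0 <= s -> 0 <= k n s by move=> s0; rewrite mulr_ge0 ?powR_ge0// exprn_ge0.
pose c : R := t `^ (1 - a) * (Gamma (1 - a) / Gamma (2 - a)).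
have Ik n : (\int[mu]_(s in `]0%R, t[) (k n s)%:E = ((q n)^-1 * (c * t ^+ n))%:E)%E.
  have := @integral_itv_bndoo R 0 t (EFin \o k n) true false; rewrite -/(EFin \o k n) => <-; last first.
    by apply/measurable_EFinP.
  rewrite (@integral_eq_beta_ker _ (1 - a) n.+1%:R)//; last first.
    move=> s; rewrite in_itv/= => /andP[s0 st].
    rewrite -[n.+1%:R]natr1 addrK powR_mulrn ?ltW// /k.
    by congr (_ `^ _ * _); ring.
  rewrite betaE_GammaE ?ltr0n//; congr EFin.
  have -> : 1 - a + n.+1%:R - 1 = 1 - a + n%:R by rewrite -natr1; ring.
  rewrite powRD; last by rewrite (gt_eqF t0) implybT.
  rewrite powR_mulrn ?ltW// /q /c /L_beta.
  have -> : 1 - a + n.+1%:R = n%:R + 2 - a by rewrite -natr1; ring.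
  have -> : Gamma n.+2%:R = n.+1%:R * Gamma n.+1%:R :> R.
    by rewrite -[n.+2%:R]natr1 GammaD1.
  have : Gamma (n%:R + 2 - a) != 0.
    by rewrite gt_eqF// Gamma_gt0// -addrA ltr_wpDl.
  have : Gamma n.+1%:R != 0 :> R by rewrite gt_eqF// Gamma_gt0.
  have : Gamma (2 - a) != 0 by rewrite gt_eqF// Gamma_gt0.
  have : n.+1%:R != 0 :> R by rewrite pnatr_eq0.
  move: (Gamma (1 - a)) (Gamma n.+1%:R) (Gamma (n%:R + 2 - a)) (Gamma (2 - a)).
  move: (n.+1%:R) => m G1 G2 G3 G4 h1 h2 h3 h4.
  by field; rewrite ?h1 ?h2 ?h3 ?h4.
have ik n : mu.-integrable `]0, t[ (EFin \o k n).
  apply/integrableP; split; first by apply/measurable_EFinP; exact: mk.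
  rewrite (_ : integral _ _ _ = \int[mu]_(s in `]0%R, t[) (k n s)%:E)%E.
    by rewrite Ik ltry.
  apply: eq_integral => s; rewrite inE/= in_itv/= => /andP[s0 _].
  by rewrite ger0_norm ?k0// ltW.
have fE n : f n = fun s => gam n * q n * k n s.
  by apply/funext => s; rewrite /f /k; ring.
have if_ n : mu.-integrable `]0, t[ (EFin \o f n).
  rewrite fE (_ : EFin \o _ = (fun u => (gam n * q n)%:E * (EFin \o k n) u)%E).
    exact: integrableZl.
  by apply/funext => u /=; rewrite EFinM.
have qn0 n : q n != 0 by rewrite mulf_neq0// ?pnatr_eq0// gt_eqF// L_beta_gt0.
have RIk n (r : R) : \int[mu]_(s in `]0, t[) (r * q n * k n s) = c * (r * t ^+ n).
  by rewrite RintegralZl// /Rintegral Ik /=; field; exact: qn0.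
have fF s : 0 < s < t -> series (f ^~ s) n @[n --> \oo] --> (t - s) `^ (- a) * derive1 X s.
  move=> st; rewrite d1//.
  have -> : series (f ^~ s) =
      fun N => (t - s) `^ (- a) * series (fun n => gam n * q n * s ^+ n) N.
    by apply/funext => N; rewrite /series/= mulr_sumr.
  by apply: cvgMr; exact: cd.
have gt : abs_pser gam t by apply: abs_pser_le gT; rewrite (ltW t0).
have nf : cvgn (series (fun n => \int[mu]_(s in `]0, t[) `|f n s|)).
  rewrite (_ : (fun n => _) = c *: (fun n => `|gam n| * t ^+ n)).
    exact: is_cvg_seriesZ.
  apply/funext => n; transitivity (c * (`|gam n| * t ^+ n)); last by [].
  rewrite -RIk; apply: eq_Rintegral => s.
  rewrite inE/= in_itv/= => /andP[s0 _].
  by rewrite fE 2!normrM (ger0_norm (q0 n)) (ger0_norm (k0 n s _))// ltW.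
have [mF IF] := @Rintegral_series R `]0, t[%classic f
  (fun s => (t - s) `^ (- a) * derive1 X s) (measurable_itv _) if_ fF nf.
(* The series describes [derive1 X] only inside the interval: the derivative is two-sided, and [X]
   is unconstrained outside [[0, T]]. The end points are negligible. *)
transitivity (\int[mu]_(s in `]0, t[) ((t - s) `^ (- a) * derive1 X s)).
  rewrite /Rintegral; congr fine.
  apply: (@integral_itv_bndoo R 0 t
    (EFin \o (fun s => (t - s) `^ (- a) * derive1 X s)) true false).
  exact/measurable_EFinP.
rewrite IF (_ : (fun n => _) = c *: (fun n => gam n * t ^+ n)); last first.
  apply/funext => n; transitivity (c * (gam n * t ^+ n)); last by [].
  rewrite -RIk; apply: eq_Rintegral => s _.
  by rewrite fE.
rewrite lim_seriesZ; last exact: is_cvg_abs_pser (ltW t0) gt.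
rewrite gE ?in_itv/= ?(ltW t0)// /c /GRing.scale/=.
by rewrite [LHS]mulrAC [LHS]mulrC.
Qed.

End caputo_power_series.

Section right_derivative.
Context {R : realType}.
Local Notation mu := (@lebesgue_measure R).
Variables (a T : R).
Hypotheses (a01 : 0 < a < 1) (T0 : 0 < T).

Lemma RLJ_right_derivative (g X : R -> R) : {within `[0, T], continuous g} ->
  (forall t, 0 <= t <= T -> X t = X 0 + RLJ a g t) ->
  lim ((fun h => h^-1 * (X h - X 0)) @ 0^'+) = g 0.
Proof.
move=> cg XE; apply/cvg_lim; first exact: Rhausdorff.
apply/cvgrPdist_le => e e0.
have /subspace_continuousP/(_ 0) := cg.
rewrite /= in_itv/= lexx (ltW T0) => /(_ isT) /cvgrPdist_le/(_ e e0).
move=> [r /= r0 Hr].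
near=> h.
have h0 : 0 < h by near: h; exact: nbhs_right_gt.
have hT : h <= T by near: h; exact: nbhs_right_le.
have hr : h < r by near: h; exact: nbhs_right_lt.
have h0T : 0 <= h <= T by rewrite (ltW h0).
rewrite XE// addrAC subrr add0r.
have cc : {within `[0, T], continuous (fun=> - g 0 : R)}.
  by apply: continuous_subspaceT => s; exact: cvg_cst.
(* Removing the constant [g 0], whose L-integral is [g 0 * h], leaves a function bounded by [e] on
   [[0, h]]. *)
have -> : RLJ a g h = RLJ a (fun s => g s + - g 0) h + g 0 * h.
  rewrite (RLJD a01 hT cg cc) -addrA; apply/esym/eqP; rewrite -subr_eq0 addrAC subrr add0r.
  have := RLJXn a01 0 (ltW h0); rewrite L_beta0// mul1r expr1 => hE.
  have -> : RLJ a (fun=> - g 0) h = - g 0 * RLJ a (fun s => s ^+ 0) h.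
    rewrite -(RLJZ a01 _ hT); last exact: (continuous_subspaceT (@exprn_continuous R 0)).
    by apply: eq_RLJ => s _; rewrite expr0 mulr1.
  by rewrite hE mulNr addNr.
rewrite mulrDr (mulrC (g 0)) mulKf ?gt_eqF// opprD addrCA subrr addr0 normrN normrM.
rewrite gtr0_norm ?invr_gt0// mulrC ler_pdivrMr//.
apply: (RLJ_le0 a01 (ltW h0) (ltW e0)).
  apply: within_continuous_measurable; apply: (within_continuous_sub hT).
  exact: within_continuousD.
move=> s; rewrite in_itv/= => /andP[s0 sh]; rewrite distrC.
apply: Hr; first by rewrite /= sub0r normrN ger0_norm// (le_lt_trans sh).
by rewrite /= in_itv/= s0 (le_trans sh).
Unshelve. all: by end_near. Qed.

End right_derivative.

(** * The L-fractional equation for vectors, from its real parts *)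

Section LD_vector.
Context {R : realType}.
Local Notation mu := (@lebesgue_measure R).
Variables (a T : R) (d : nat).
Hypotheses (a01 : 0 < a < 1) (T0 : 0 < T).
Implicit Types (x g : R -> 'cV[R[i]]_d).

Lemma part_cder b x t i :
  part b (cder x t i 0) = derive1 (fun s => part b (x s i 0)) t.
Proof. by rewrite mxE; case: b. Qed.

Lemma part_rder0 b x i : part b (rder0 x i 0) =
  lim ((fun h => h^-1 * (part b (x h i 0) - part b (x 0 i 0))) @ 0^'+).
Proof. by rewrite mxE; case: b. Qed.

Lemma part_LD b x t i : t != 0 -> part b (LD a x t i 0) =
  Gamma (2 - a) / t `^ (1 - a) * ((Gamma (1 - a))^-1 *
    \int[mu]_(s in `[0, t]) ((t - s) `^ (- a) * derive1 (fun s => part b (x s i 0)) s)).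
Proof.
move=> /negbTE t0; rewrite /LD t0 mxE partZ mxE partZ part_cint; congr (_ * (_ * _)).
by apply: eq_Rintegral => s _; rewrite mxE partZ part_cder.
Qed.

Lemma LD_cancel (t y : R) : 0 < t ->
  Gamma (2 - a) / t `^ (1 - a) * ((Gamma (1 - a))^-1 *
    (Gamma (1 - a) / Gamma (2 - a) * (t `^ (1 - a) * y))) = y.
Proof.
move=> t0; have tp : t `^ (1 - a) != 0 by rewrite gt_eqF// powR_gt0.
have := a01 => /andP[a0 a1].
have : Gamma (1 - a) != 0 by rewrite gt_eqF// Gamma_gt0// subr_gt0.
have : Gamma (2 - a) != 0 by rewrite gt_eqF// Gamma_gt0//; lra.
move: (Gamma (1 - a)) (Gamma (2 - a)) (t `^ (1 - a)) tp => G1 G2 p p0 h1 h2.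
by field; rewrite p0 h1 h2.
Qed.

Lemma LD_ae x g : ccont_on T g ->
  (forall t, 0 <= t <= T -> x t = x 0 + LJ a g t) -> cabs_cont T x ->
  {ae mu, forall t, 0 <= t <= T -> LD a x t = g t}.
Proof.
move=> /ccont_onP cg xE [/cintegrableP ix xint].
have H (p : bool * 'I_d) : {ae mu, forall t, 0 <= t < T ->
    \int[mu]_(s in `[0, t]) ((t - s) `^ (- a) * derive1 (fun s => part p.1 (x s p.2 0)) s) =
    Gamma (1 - a) / Gamma (2 - a) * (t `^ (1 - a) * part p.1 (g t p.2 0))}.
  case: p => b i /=; apply: (caputo_ae a01 T0 (X := fun s => part b (x s i 0)) (cg b i)).
  - apply: eq_integrable (ix b i) => // s _.
    by rewrite /= part_cder.
  - move=> t tT; rewrite {1}xint// mxE partD part_cint; congr (_ + _).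
    by apply: eq_Rintegral => s _; rewrite part_cder.
  - by move=> t tT; rewrite {1}xE// mxE partD part_LJ.
have aeF := ae_filter_ringOfSetsType mu.
(* Two single points are discarded: 0, where [LD] is a right derivative, and [T], which the scalar
   result does not reach. *)
have aeT (c : R) : {ae mu, forall t, t != c}.
  exists [set c]; split => //; first exact: lebesgue_measure_set1.
  by move=> t /= /negP; rewrite negbK => /eqP.
have Hall : {ae mu, forall t (p : bool * 'I_d), 0 <= t < T ->
    \int[mu]_(s in `[0, t]) ((t - s) `^ (- a) * derive1 (fun s => part p.1 (x s p.2 0)) s) =
    Gamma (1 - a) / Gamma (2 - a) * (t `^ (1 - a) * part p.1 (g t p.2 0))}.
  (* The exceptional null set depends on the component and the part; induction along the enumeration
     of these finitely many indices unites the null sets. *)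
  suff : {ae mu, forall t (p : bool * 'I_d), p \in enum {: bool * 'I_d} -> 0 <= t < T ->
    \int[mu]_(s in `[0, t]) ((t - s) `^ (- a) * derive1 (fun s => part p.1 (x s p.2 0)) s) =
    Gamma (1 - a) / Gamma (2 - a) * (t `^ (1 - a) * part p.1 (g t p.2 0))}.
    by apply: filterS => t h p; apply: h; rewrite mem_enum.
  elim: (enum _) => [|q l IHl]; first exact: aeW.
  apply: filterS2 IHl (H q) => t hl hq p.
  by rewrite inE => /orP[/eqP ->|/hl].
apply: filterS3 Hall (aeT 0) (aeT T) => t h t0 tT /andP[t0' tT'].
apply/matrixP => i j; rewrite ord1; apply: partP => b.
have tp : 0 < t by rewrite lt_neqAle eq_sym t0.
rewrite part_LD// (h (b, i)) ?LD_cancel//.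
by rewrite t0' lt_neqAle tT.
Qed.

Lemma norm1_le_normc (z : R[i]) : norm1 z <= 2 * Normc.normc z.
Proof.
case: z => u v; rewrite /norm1 /Normc.normc /= mulr2n mulrDl mul1r.
by rewrite lerD// -sqrtr_sqr ler_sqrt ?addr_ge0 ?sqr_ge0// ?lerDl ?lerDr sqr_ge0.
Qed.

Definition psum (c : nat -> 'cV[R[i]]_d) (t : R) N : 'cV[R[i]]_d :=
  \sum_(n < N) (t ^+ n)%:C *: c n.

Lemma part_psum b c t N i : part b (psum c t N i 0) =
  pseries (fun n => part b (c n i 0)) t N.
Proof.
rewrite summxE part_sum /pseries seriesEord; apply: eq_bigr => n _.
by rewrite mxE partZ mulrC.
Qed.

Lemma psum_linear (A : 'M[R[i]]_d) c e t N :
  A *m psum c t N + psum e t N = psum (fun n => A *m c n + e n) t N.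
Proof.
rewrite /psum; elim: N => [|N IHN]; first by rewrite !big_ord0 mulmx0 addr0.
rewrite !big_ord_recr/= -IHN mulmxDr scalerDr -scalemxAr.
by rewrite addrACA.
Qed.

(** Passes from componentwise expansions to vector partial sums, on which [A] acts directly, with a
    single norm series at [T] controlling all parts. *)
Lemma cpser_onP x : cpser_on T x -> exists c : nat -> 'cV[R[i]]_d,
  (forall t, 0 <= t <= T -> ctends (psum c t) (x t)) /\
  cvgn (series (fun n => normv (c n) * T ^+ n)).
Proof.
move=> [c Hc]; exists c.
have TT : 0 <= T <= T by rewrite (ltW T0) lexx.
have cT : cvgn (series (fun n => normv (c n) * T ^+ n)).
  have cs : cvgn (fun N => \sum_i 2 * series (fun n => Normc.normc (c n i 0) * T ^+ n) N).
    apply: cvgP; apply: cvg_sumr => i; apply: cvgMr.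
    exact: (Hc T TT i).1.
  have cs' : cvgn (series (fun n => \sum_i 2 * (Normc.normc (c n i 0) * T ^+ n))).
    rewrite (_ : series _ = (fun N => \sum_i 2 * series (fun n => Normc.normc (c n i 0) * T ^+ n) N))//.
    apply/funext => N; rewrite /series/= exchange_big/=; apply: eq_bigr => i _.
    by rewrite mulr_sumr.
  apply: series_le_cvg cs' => n.
  - by rewrite mulr_ge0 ?normv_ge0// exprn_ge0// ltW.
  - apply: sumr_ge0 => i _; rewrite mulr_ge0// mulr_ge0 ?exprn_ge0 ?(ltW T0)//.
    by case: (c n i 0) => u v; rewrite /= sqrtr_ge0.
  - rewrite mulr_suml; apply: ler_sum => i _; rewrite mulrA.
    by rewrite ler_wpM2r ?norm1_le_normc// exprn_ge0// ltW.
split => // t tT b i j; rewrite ord1.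
have [t0 tT'] := andP tT.
have ab : abs_pser (fun n => part b (c n i 0)) t.
  apply: (abs_pser_le tT); apply: series_le_cvg cT => n.
  - by rewrite mulr_ge0// exprn_ge0// ltW.
  - by rewrite mulr_ge0 ?normv_ge0// exprn_ge0// ltW.
  - by rewrite ler_wpM2r ?part_le_normv// exprn_ge0// ltW.
have := is_cvg_abs_pser t0 ab.
have [_ [xR xI]] := Hc t tT i.
have -> : part b (x t i 0) = limn (pseries (fun n => part b (c n i 0)) t).
  by case: b {ab}; [exact: xR|exact: xI].
have -> // : (fun k => part b (psum c t k i 0)) = pseries (fun n => part b (c n i 0)) t.
by apply/funext => N; exact: part_psum.
Qed.

Lemma LD_pser A x th : ccont_on T (fun s => A *m x s + th s) ->
  (forall t, 0 <= t <= T -> x t = x 0 + LJ a (fun s => A *m x s + th s) t) ->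
  cpser_on T x -> cpser_on T th ->
  forall t, 0 <= t <= T -> LD a x t = A *m x t + th t.
Proof.
move=> /ccont_onP cg xE /cpser_onP[c [xc cx]] /cpser_onP[e [the ce]] t tT.
have [t0 tT'] := andP tT.
apply/matrixP => i j; rewrite ord1; apply: partP => b.
pose g s := part b ((A *m x s + th s) i 0).
have XE s : 0 <= s <= T -> part b (x s i 0) = part b (x 0 i 0) + RLJ a g s.
  by move=> sT; rewrite {1}xE// mxE partD part_LJ.
have [t00|tn0] := eqVneq t 0.
  rewrite t00 {1}/LD eqxx part_rder0.
  exact: (RLJ_right_derivative a01 T0 (X := fun s => part b (x s i 0)) (cg b i) XE).
have tp : 0 < t by rewrite lt_neqAle eq_sym tn0.
pose gam n := part b ((A *m c n + e n) i 0).
have gT : abs_pser gam T.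
  have cS : cvgn (series (fun n => normm A * (normv (c n) * T ^+ n) + normv (e n) * T ^+ n)).
    rewrite (_ : (fun n => _) = (normm A *: (fun n => normv (c n) * T ^+ n)) +
      (fun n => normv (e n) * T ^+ n)).
      by apply: is_cvg_seriesD => //; exact: is_cvg_seriesZ.
    by apply/funext => n.
  have Tn n : 0 <= T ^+ n by rewrite exprn_ge0// ltW.
  apply: series_le_cvg cS => n.
  - by rewrite mulr_ge0.
  - by rewrite addr_ge0 ?mulr_ge0 ?normm_ge0 ?normv_ge0.
  - rewrite mulrA -mulrDl ler_wpM2r// (le_trans (part_le_normv _ _ _))//.
    by rewrite (le_trans (normvD _ _))// lerD// normv_mul.
have gE : {in `[0, T], forall s, g s = limn (pseries gam s)}.
  move=> s; rewrite in_itv/= => sT; apply/esym/cvg_lim => //.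
  have : ctends (fun N => A *m psum c s N + psum e s N) (A *m x s + th s).
    apply: ctendsD; last exact: the.
    by apply: ctendsM; [exact: ctends_cst|exact: xc].
  move=> /(_ b i 0); apply: cvg_trans; apply: near_eq_cvg; near=> N.
  by rewrite -[RHS](@part_psum b (fun n => A *m c n + e n) s N i) psum_linear.
rewrite part_LD// (caputo_pser a01 T0 (X := fun s => part b (x s i 0)) (cg b i) gT gE XE) ?tp//.
exact: LD_cancel.
Unshelve. all: by end_near. Qed.

End LD_vector.

Theorem mainTheorem9 (R : realType) (d : nat) (a T : R)
  (A : 'M[R[i]]_d) (th : R -> 'cV[R[i]]_d) (x0 : 'cV[R[i]]_d) :
  0 < a < 1 -> 0 < T -> ccont_on T th ->
  let x := sol a A th x0 in
  (* x is well defined on [0,T] *)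
  (forall t, 0 <= t <= T ->
     ccvg (ML_partial a (t%:C *: A)) /\ ccvg (LJ_partial a A th t) /\
     (forall j, cintegrable `[0, t] (fun s => (Lkernel a t s)%:C *: LJn j a th s))) /\
  (* x belongs to C[0,T] *)
  ccont_on T x /\
  (* x solves the integral equation on [0,T] *)
  (forall t, 0 <= t <= T ->
     cintegrable `[0, t] (fun s => (Lkernel a t s)%:C *: (A *m x s + th s)) /\
     x t = x0 + ((Gamma a * Gamma (2 - a))^-1)%:C *:
             cint `[0, t] (fun s => (Lkernel a t s)%:C *: (A *m x s + th s))) /\
  (* absolutely continuous case: LD^a x = A x + theta a.e. on [0,T], x(0) = x0 *)
  (cabs_cont T x -> cabs_cont T th ->
     {ae lebesgue_measure, forall t, 0 <= t <= T -> LD a x t = A *m x t + th t}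
     /\ x 0 = x0) /\
  (* power series case: the equation holds everywhere on [0,T] *)
  (cpser_on T x -> cpser_on T th ->
     forall t, 0 <= t <= T -> LD a x t = A *m x t + th t).
Proof.
move=> a01 T0 cth x; have T0' := ltW T0.
have x0E : x 0 = x0 by exact: (sol0 A x0 a01 T0' cth).
have cg : ccont_on T (fun s => A *m x s + th s) by exact: ccont_on_rhs.
have xE t : 0 <= t <= T -> x t = x 0 + LJ a (fun s => A *m x s + th s) t.
  by move=> tT; rewrite x0E; exact: sol_integral_eq a01 T0' cth _ tT.
split.
  move=> t tT; split; first exact: ccvg_ML_partial a01 T0' _ tT.
  split; first exact: ccvg_LJ_partial a01 T0' cth _ tT.
  move=> j; case/andP: tT => _ tT; apply: (cintegrable_Lkernel a01 tT).
  exact: ccont_on_LJn.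
split; first exact: ccont_on_sol.
split.
  move=> t tT; split; last by rewrite xE// x0E.
  by case/andP: tT => _ tT; exact: (cintegrable_Lkernel a01 tT).
split; last exact: LD_pser.
by move=> ax _; split => //; exact: (LD_ae a01 T0 cg).
Qed.
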